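(* Let $X_0(\beta_i), X_F(\beta_i)\in\mathbb{R}^n$, $i=1,\ldots,N$, be initial and target states of the sampled linear ensemble system $$\frac{d}{dt}X(t,\beta_i)=A(t,\beta_i)X(t,\beta_i)+B(t,\beta_i)u(t),\qquad i=1,\ldots,N,\ t\in[0,T],$$ where each individual system (indexed by $\beta_i$) is controllable on $[0,T]$. Let $\lambda_i\in(0,1)$ satisfy $\sum_{i=1}^N\lambda_i=1$, let $u^{(0)}\in L^2([0,T],\mathbb{R}^m)$ be arbitrary, and let $\{u^{(k)}\}$ be the control sequence generated by $$u^{(k+1)}=\Big(I_d-\sum_{i=1}^N\lambda_i L_i^*(L_iL_i^* )^{-1}L_i\Big)u^{(k)}+\sum_{i=1}^N\lambda_i L_i^*(L_iL_i^* )^{-1}\xi_i,\qquad k=0,1,2,\ldots.$$ Then the target $(X_F(\beta_i))_{i=1}^N$ is ensemble reachable from $(X_0(\beta_i))_{i=1}^N$ if and only if $\{u^{(k)}\}$ converges in norm to some $u^*\in L^2([0,T],\mathbb{R}^m)$ and $u^*$ satisfies $L_iu^*=\xi_i$ for all $i=1,\ldots,N$.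
   Context: Setting: $T\in(0,\infty)$ is fixed; $\beta_1,\ldots,\beta_N$ are parameter values in a compact set $K\subset\mathbb{R}$; for each $i$, $A(\cdot,\beta_i)\in L^\infty([0,T],\mathbb{R}^{n\times n})$ and $B(\cdot,\beta_i)\in L^2([0,T],\mathbb{R}^{n\times m})$; the same control $u\in L^2([0,T],\mathbb{R}^m)$ is applied to all $N$ systems, and $X(t,\beta_i)\in\mathbb{R}^n$ is the state of the $i$-th system. $\Phi(t,s,\beta_i)$ is the transition matrix of the $i$-th system: $\frac{\partial}{\partial t}\Phi(t,s,\beta_i)=A(t,\beta_i)\Phi(t,s,\beta_i)$ (for a.e. $t$), $\Phi(s,s,\beta_i)=I$. The bounded linear operator $L_i:L^2([0,T],\mathbb{R}^m)\to\mathbb{R}^n$ is $L_i(u)=\int_0^T\Phi(T,\sigma,\beta_i)B(\sigma,\beta_i)u(\sigma)\,d\sigma$, $L_i^*$ is its adjoint, and $\xi_i=X_F(\beta_i)-\Phi(T,0,\beta_i)X_0(\beta_i)\in\mathbb{R}^n$. $I_d$ is the identity operator on $L^2([0,T],\mathbb{R}^m)$. Controllability of the $i$-th system means that $L_i$ has range $\mathbb{R}^n$, equivalently that $L_iL_i^*$ is invertible. Ensemble reachability: the target $(X_F(\beta_i))_{i=1}^N$ is ensemble reachable from $(X_0(\beta_i))_{i=1}^N$ if for every $\varepsilon>0$ there is a piecewise constant control $u:[0,T]\to\mathbb{R}^m$ such that the solution with $X(0,\beta_i)=X_0(\beta_i)$ for all $i$ satisfies $\rho(X(T,\cdot),X_F(\cdot))<\varepsilon$,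 where $\rho$ is the Euclidean metric on the space $(\mathbb{R}^n)^N$ of $\mathbb{R}^n$-valued functions on $\{\beta_1,\ldots,\beta_N\}$. *)

(* Defs.v *)
From HB Require Import structures.
From mathcomp Require Export all_boot all_order all_algebra.
From mathcomp Require Export all_classical all_reals all_analysis.

Export Order.TTheory GRing.Theory Num.Theory.
Export numFieldNormedType.Exports.

Set Implicit Arguments.
Unset Strict Implicit.
Unset Printing Implicit Defensive.

Local Open Scope classical_set_scope.
Local Open Scope ring_scope.

(* Functions on [0, T] are total functions on R whose values outside [0, T] are
   irrelevant; elements of L^p([0, T]) are represented by functions, not by
   classes, and equality in L^p is equality almost everywhere on [0, T]. *)

Definition Lp_itv (R : realType) (T : R) (p : \bar R) (a b : nat)
    (f : R -> 'M[R]_(a, b)) : Prop :=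
  forall i j,
    ((fun t => f t i j) \_ `[0, T]) \in Lfun (@lebesgue_measure R) p.

Definition L2dot (R : realType) (T : R) (m : nat) (u v : R -> 'cV[R]_m) : R :=
  \int[@lebesgue_measure R]_(t in `[0, T]) (\sum_j u t j 0 * v t j 0).

Definition L2norm (R : realType) (T : R) (m : nat) (u : R -> 'cV[R]_m) : R :=
  Num.sqrt (L2dot T u u).

Definition edot (R : realType) (n : nat) (x y : 'cV[R]_n) : R :=
  \sum_j x j 0 * y j 0.

Definition absolutely_continuous_on (R : realType) (V : normedModType R)
    (a b : R) (f : R -> V) : Prop :=
  forall e : R, 0 < e -> exists2 d : R, 0 < d &
    forall (k : nat) (p q : 'I_k -> R),
      (forall i, a <= p i /\ p i <= q i /\ q i <= b) ->
      trivIset setT (fun i => [set` `]p i, q i[]) ->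
      \sum_i (q i - p i) < d ->
      \sum_i `|f (q i) - f (p i)| < e.

(* Caratheodory solution on [0, T] of the matrix equation dY/dt = F(t, Y). *)
Definition ode_solution (R : realType) (T : R) (a b : nat)
    (F : R -> 'M[R]_(a, b) -> 'M[R]_(a, b)) (Y : R -> 'M[R]_(a, b)) : Prop :=
  absolutely_continuous_on 0 T Y /\
  {ae @lebesgue_measure R, forall t,
    0 < t < T -> is_derive t (1 : R) Y (F t (Y t))}.

Definition transition_matrix (R : realType) (T : R) (n : nat)
    (A : R -> 'M[R]_n) (Phi : R -> R -> 'M[R]_n) : Prop :=
  forall s, 0 <= s <= T ->
    ode_solution T (fun t Y => A t *m Y) (fun t => Phi t s) /\
    Phi s s = 1%:M.

Definition control_solution (R : realType) (T : R) (n m : nat)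
    (A : R -> 'M[R]_n) (B : R -> 'M[R]_(n, m)) (u : R -> 'cV[R]_m)
    (X : R -> 'cV[R]_n) : Prop :=
  ode_solution T (fun t x => A t *m x + B t *m u t) X.

Definition control_op (R : realType) (T : R) (n m : nat)
    (Phi : R -> R -> 'M[R]_n) (B : R -> 'M[R]_(n, m))
    (u : R -> 'cV[R]_m) : 'cV[R]_n :=
  \col_j \int[@lebesgue_measure R]_(s in `[0, T])
           ((Phi T s *m B s *m u s) j 0).

Definition is_adjoint (R : realType) (T : R) (n m : nat)
    (L : (R -> 'cV[R]_m) -> 'cV[R]_n) (Ls : 'cV[R]_n -> (R -> 'cV[R]_m)) :
    Prop :=
  forall x, Lp_itv T 2%:E (Ls x) /\
    forall u, Lp_itv T 2%:E u -> edot (L u) x = L2dot T u (Ls x).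

Definition controllable (R : realType) (T : R) (n m : nat)
    (L : (R -> 'cV[R]_m) -> 'cV[R]_n) : Prop :=
  forall x, exists2 u, Lp_itv T 2%:E u & L u = x.

(* y |-> L^* ((L L^* )^-1 y), the inverse being that of the map L L^* of R^n
   (which is a bijection exactly when L has range R^n). *)
Definition adj_gram_inv (R : realType) (n m : nat)
    (L : (R -> 'cV[R]_m) -> 'cV[R]_n) (Ls : 'cV[R]_n -> (R -> 'cV[R]_m))
    (y : 'cV[R]_n) : R -> 'cV[R]_m :=
  Ls ('pinv_(fun=> 0) setT (L \o Ls) y).

Definition piecewise_constant (R : realType) (T : R) (m : nat)
    (u : R -> 'cV[R]_m) : Prop :=
  exists (k : nat) (t : nat -> R),
    [/\ t 0%N = 0, t k = T, (forall i, (i < k)%N -> t i < t i.+1) &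
      forall i, (i < k)%N ->
        exists c, forall x, t i < x < t i.+1 -> u x = c].

Definition ensemble_dist (R : realType) (N n : nat)
    (X Y : 'I_N -> 'cV[R]_n) : R :=
  Num.sqrt (\sum_i \sum_j (X i j 0 - Y i j 0) ^+ 2).

Definition ensemble_reachable (R : realType) (T : R) (N n m : nat)
    (beta : 'I_N -> R) (A : R -> R -> 'M[R]_n) (B : R -> R -> 'M[R]_(n, m))
    (X0 XF : R -> 'cV[R]_n) : Prop :=
  forall e : R, 0 < e ->
    exists (u : R -> 'cV[R]_m) (X : R -> 'I_N -> 'cV[R]_n),
      [/\ piecewise_constant T u,
          forall i, control_solution T (A ^~ (beta i)) (B ^~ (beta i)) u
                      (X ^~ i),
          forall i, X 0 i = X0 (beta i) &
          ensemble_dist (X T) (fun i => XF (beta i)) < e].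

(* Main.v *)
Require Import Defs.
From mathcomp Require Import ring lra measurable_realfun ess_sup_inf.

(** Put [xi i := X_F - Phi(T,0) X_0].  By variation of constants a control [u]
    steers system [i] from [X_0] to [X_F] exactly when [L i u = xi i], and the
    endpoint it reaches differs from [X_F] by [L i u - xi i].  Ensemble
    reachability therefore says that the vector [xi] of all targets is a limit
    of values of the joint operator [u |-> (L i u)_i] at piecewise constant
    controls.

    That joint operator has finite rank: its coordinates are the inner products
    with the finitely many functions [L_i^* e_j].  Everything that is needed
    about it is linear algebra with their Gram matrix.

    If the target is reachable, [xi] is in the closure of the range, hence in
    the range ([range_closed]), so [L i w = xi i] for some [w] in L^2.  In terms
    of [e_k = u_k - w] the iteration reads [e_(k+1) = e_k - sum_i lambda_i P_i
    e_k], where [P_i] is the orthogonal projection onto the range of [L_i^*].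
    The component [h] of [e_0] in the common kernel of the [L_i] never changes.
    On the complementary component, which stays in the finite-dimensional span
    of the [L_i^* e_j], the quadratic form [sum_i lambda_i |P_i e|^2] is
    coercive, and convexity of the square shows that one step lowers [|e|^2] by
    at least this amount.  So [e_k] tends to [h] geometrically, and the limit
    [w + h] of the controls still solves all the equations ([cimmino]).

    Conversely, let [ustar] be an L^2 control with [L i ustar = xi i].  An L^2
    function orthogonal to all controls that are constant on the cells of a
    uniform grid vanishes almost everywhere ([grid_constant_dense]).  For an
    operator of finite rank this means that such controls attain every value in
    its range, so that some piecewise constant control reaches the target
    exactly ([dense_interpolation]).

    The analytic part is the theory of Caratheodory solutions.  Its basis is
    [ac_nonincreasing]: an absolutely continuous function with nonpositive
    derivative almost everywhere is nonincreasing.  It gives a Gronwall bound,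
    hence uniqueness and the cocycle identity [Phi t s = Phi t r Phi r s].
    Therefore [Phi T s] is the inverse of [Phi s T], is bounded and absolutely
    continuous in [s], and
      [X t = Phi t T (Phi T 0 x_0 + int_0^t Phi T s B s u s ds)]
    is a solution; by uniqueness every solution has this form
    ([variation_of_constants]). *)

Set Implicit Arguments.
Unset Strict Implicit.
Unset Printing Implicit Defensive.

Local Open Scope classical_set_scope.
Local Open Scope ring_scope.

(** * Finite families in a semi-inner product space *)

(** Finite-dimensional duality for a subspace given as a predicate: a matrix
    with rows in [W] and maximal rank spans [W], and its cokernel provides the
    vectors [z] that cut [W] out. *)
Lemma subspace_orthogonal (F : fieldType) (q : nat) (W : 'rV[F]_q -> Prop)
    (y : 'rV[F]_q) :
  W 0 -> (forall v w, W v -> W w -> W (v + w)) ->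
  (forall c v, W v -> W (c *: v)) ->
  (forall z : 'cV[F]_q, (forall w, W w -> w *m z = 0) -> y *m z = 0) -> W y.
Proof.
move=> W0 WD WZ orth.
pose inW k (M : 'M[F]_(k, q)) := forall i, W (row i M).
have subW k (M : 'M[F]_(k, q)) v : inW k M -> (v <= M)%MS -> W v.
  move=> MW /submxP[d ->]; rewrite mulmx_sum_row.
  by elim/big_ind : _ => // i _; apply: WZ; exact: MW.
pose Q r := asbool (exists k (M : 'M[F]_(k, q)), inW k M /\ \rank M = r).
have Q0 : exists r, Q r.
  exists 0%N; apply/asboolP; exists 0%N, (0 : 'M[F]_(0, q)); split=> [[]//|].
  exact: mxrank0.
have Qq r : Q r -> (r <= q)%N.
  by move=> /asboolP[k [M [_ <-]]]; exact: rank_leq_col.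
have [_ /asboolP[k [M [MW <-]]] maxM] := ex_maxnP Q0 Qq.
have WM w : W w -> (w <= M)%MS.
  move=> Ww; apply/negPn/negP => nwM.
  have /maxM : Q (\rank (col_mx M w)).
    apply/asboolP; exists (k + 1)%N, (col_mx M w); split => // i.
    case: (split_ordP i) => j ->; first by rewrite rowKu.
    by rewrite rowKd (ord1 j) (_ : row 0 w = w)//; apply/rowP => l; rewrite mxE.
  (* Appending a row outside the span would increase the maximal rank. *)
  apply/negP; rewrite -ltnNge rank_ltmx// ltmxE col_mx_sub submx_refl.
  by rewrite (negPf nwM) -addsmxE addsmxSl.
apply: (subW _ M) => //; rewrite submxE; apply/eqP/rowP => j.
have /colP/(_ 0) : y *m col j (cokermx M) = 0.
  apply: orth => w /WM /submxP[d ->].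
  by rewrite colE -mulmxA (mulmxA M) mulmx_coker mul0mx mulmx0.
by rewrite !mxE => yj; rewrite -[RHS]yj; apply: eq_bigr => l _; rewrite !mxE.
Qed.

(** Square integrable functions are not identified when they agree almost
    everywhere, and the integral of their product means nothing outside L^2.
    So the form is only asked to be positive semidefinite, and only on the
    subspace [D] of a space of functions. *)
Record semi_inner (R : realType) (V : lmodType R) (D : V -> Prop)
    (dot : V -> V -> R) : Prop := SemiInner {
  si_mem0 : D 0;
  si_memD : forall u v, D u -> D v -> D (u + v);
  si_memZ : forall a u, D u -> D (a *: u);
  si_sym : forall u v, D u -> D v -> dot u v = dot v u;
  si_addl : forall u v w, D u -> D v -> D w ->
    dot (u + v) w = dot u w + dot v w;
  si_scalel : forall a u v, D u -> D v -> dot (a *: u) v = a * dot u v;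
  si_ge0 : forall u, D u -> 0 <= dot u u }.

Section SemiInner.
Context (R : realType) (V : lmodType R) (D : V -> Prop) (dot : V -> V -> R).
Hypothesis dotP : semi_inner D dot.

Let D0 := si_mem0 dotP.
Let DD := si_memD dotP.
Let DZ := si_memZ dotP.

Lemma si_memB u v : D u -> D v -> D (u - v).
Proof. by move=> Du Dv; apply: DD => //; rewrite -scaleN1r; exact: DZ. Qed.

Lemma si_mem_sum (I : Type) (r : seq I) (a : I -> V) :
  (forall i, D (a i)) -> D (\sum_(i <- r) a i).
Proof. by move=> Da; elim/big_ind : _ => // i _; exact: Da. Qed.

Let Dsum := si_mem_sum.

Lemma si_0l v : D v -> dot 0 v = 0.
Proof. by move=> Dv; rewrite -(scale0r 0) (si_scalel dotP)// mul0r. Qed.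

Lemma si_Nl u v : D u -> D v -> dot (- u) v = - dot u v.
Proof. by move=> Du Dv; rewrite -scaleN1r (si_scalel dotP)// mulN1r. Qed.

Lemma si_Bl u v w : D u -> D v -> D w -> dot (u - v) w = dot u w - dot v w.
Proof.
by move=> *; rewrite (si_addl dotP)// ?si_Nl// -scaleN1r; exact: DZ.
Qed.

Lemma si_addr u v w : D u -> D v -> D w -> dot w (u + v) = dot w u + dot w v.
Proof.
move=> Du Dv Dw.
by rewrite !(si_sym dotP Dw)// ?(si_addl dotP)//; exact: DD.
Qed.

Lemma si_Br u v w : D u -> D v -> D w -> dot w (u - v) = dot w u - dot w v.
Proof.
move=> Du Dv Dw.
by rewrite !(si_sym dotP Dw)// ?si_Bl//; exact: si_memB.
Qed.

Lemma sqnormB u v : D u -> D v ->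
  dot (u - v) (u - v) = dot u u - dot v u *+ 2 + dot v v.
Proof.
move=> Du Dv; rewrite si_Bl ?si_Br//; last exact: si_memB.
by rewrite (si_sym dotP Du Dv); ring.
Qed.

Lemma si_suml (I : Type) (r : seq I) (c : I -> R) (a : I -> V) v :
  (forall i, D (a i)) -> D v ->
  dot (\sum_(i <- r) c i *: a i) v = \sum_(i <- r) c i * dot (a i) v.
Proof.
move=> Da Dv; elim: r => [|i r IH]; first by rewrite !big_nil si_0l.
rewrite !big_cons (si_addl dotP)// ?IH ?(si_scalel dotP)//.
  exact: DZ.
by apply: Dsum => j; exact: DZ.
Qed.

Lemma si_sumr (I : Type) (r : seq I) (c : I -> R) (a : I -> V) v :
  (forall i, D (a i)) -> D v ->
  dot v (\sum_(i <- r) c i *: a i) = \sum_(i <- r) c i * dot v (a i).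
Proof.
move=> Da Dv; rewrite (si_sym dotP)//; last by apply: Dsum => j; exact: DZ.
by rewrite si_suml//; apply: eq_bigr => i _; rewrite (si_sym dotP).
Qed.

(** The quadratic [|u - t v|^2] in [t] has no negative value; when [v] is a null
    vector it is affine, which forces [dot u v = 0]. *)
Lemma cauchy_schwarz u v : D u -> D v ->
  dot u v ^+ 2 <= dot u u * dot v v.
Proof.
move=> Du Dv.
have sq t : 0 <= dot u u - t * dot u v *+ 2 + t ^+ 2 * dot v v.
  have Dtv : D (t *: v) by exact: DZ.
  have := si_ge0 dotP (si_memB Du Dtv).
  rewrite sqnormB// !(si_scalel dotP)// (si_sym dotP Dv Du).
  rewrite (si_sym dotP Dv)// (si_scalel dotP)//.
  by congr (0 <= _); ring.
have := si_ge0 dotP Dv; rewrite le_eqVlt => /predU1P[v0|v0].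
  have [->|uv0] := eqVneq (dot u v) 0.
    by rewrite expr0n/= mulr_ge0// (si_ge0 dotP).
  (* At this [t] the affine function takes the value -1. *)
  have := sq ((dot u u + 1) / (dot u v *+ 2)).
  rewrite -v0 mulr0 addr0.
  have -> : (dot u u + 1) / (dot u v *+ 2) * dot u v *+ 2 = dot u u + 1.
    by field.
  lra.
have := sq (dot u v / dot v v).
have -> : dot u u - dot u v / dot v v * dot u v *+ 2 +
    (dot u v / dot v v) ^+ 2 * dot v v =
    (dot u u * dot v v - dot u v ^+ 2) / dot v v.
  by field; rewrite gt_eqF.
by rewrite pmulr_lge0 ?invr_gt0// subr_ge0.
Qed.

Lemma null_orthogonal u v : D u -> D v -> dot v v = 0 -> dot u v = 0.
Proof.
move=> Du Dv v0; have := cauchy_schwarz Du Dv.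
by rewrite v0 mulr0 => uv; apply/eqP; rewrite -sqrf_eq0 eq_le uv sqr_ge0.
Qed.

(** The difference of the two sides is the variance
    [sum_i lam i * |p i - s|^2]. *)
Lemma convex_sqnorm (I : finType) (lam : I -> R) (p : I -> V) :
  (forall i, D (p i)) -> (forall i, 0 <= lam i) -> \sum_i lam i = 1 ->
  dot (\sum_i lam i *: p i) (\sum_i lam i *: p i) <=
  \sum_i lam i * dot (p i) (p i).
Proof.
move=> Dp lam0 lam1; set s := \sum_i lam i *: p i.
have Ds : D s by apply: Dsum => i; exact: DZ.
have : 0 <= \sum_i lam i * dot (p i - s) (p i - s).
  apply: sumr_ge0 => i _; apply: mulr_ge0 => //.
  by apply: (si_ge0 dotP); exact: si_memB.
have -> : \sum_i lam i * dot (p i - s) (p i - s) =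
   \sum_i lam i * dot (p i) (p i) - (\sum_i lam i * dot (p i) s) *+ 2
   + (\sum_i lam i) * dot s s.
  rewrite mulr_suml -sumrMnl -sumrB -big_split/=; apply: eq_bigr => i _.
  by rewrite sqnormB// (si_sym dotP Ds)//; ring.
by rewrite -si_suml// lam1; lra.
Qed.

(** Orthogonal projection onto the span of a finite, possibly dependent,
    family [a]; [H] is a generalized inverse of the Gram matrix [G].  The normal
    equations are solvable because a vector in the kernel of [G] yields a null
    combination of the [a i], which is orthogonal to every [v].  That the
    coefficients are linear in the numbers [dot v (a r)], with a matrix
    independent of [v], is what makes the estimates below uniform. *)
Lemma gram_projection (I : finType) (a : I -> V) : (forall i, D (a i)) ->
  exists H : I -> I -> R, forall v, D v -> forall p,
    dot (\sum_q (\sum_r H q r * dot v (a r)) *: a q) (a p) = dot v (a p).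
Proof.
move=> Da.
pose G := \matrix_(i < #|I|, j < #|I|) dot (a (enum_val i)) (a (enum_val j)).
exists (fun q r => pinvmx G (enum_rank r) (enum_rank q)) => v Dv p.
pose y := \row_(j < #|I|) dot v (a (enum_val j)).
have yG : (y <= G)%MS.
  rewrite submxE; apply/eqP/rowP => k; rewrite !mxE.
  pose w := \sum_(j < #|I|) cokermx G j k *: a (enum_val j).
  have Dw : D w by apply: Dsum => j; exact: DZ.
  suff : dot w w = 0.
    move=> /(null_orthogonal Dv Dw); rewrite /w si_sumr// => vw.
    by rewrite -[RHS]vw; apply: eq_bigr => j _; rewrite mxE mulrC.
  rewrite {1}/w si_suml// big1// => i _.
  rewrite /w si_sumr//.
  have /matrixP/(_ i k) := mulmx_coker G.
  rewrite !mxE => GC.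
  rewrite [X in _ * X](_ : _ = 0) ?mulr0// -[RHS]GC.
  by apply: eq_bigr => j _; rewrite !mxE mulrC.
have /rowP/(_ (enum_rank p)) := mulmxKpV yG.
rewrite !mxE enum_rankK => <-.
rewrite si_suml// big_enum_val/=; apply: eq_bigr => j _.
rewrite !mxE enum_rankK; congr (_ * _).
rewrite big_enum_val/=; apply: eq_bigr => i _.
by rewrite !mxE !enum_valK mulrC.
Qed.

(** A subspace of a finite-dimensional space is closed.  The candidate
    [w] has coefficients [H xi]; the error [dot w (a p) - xi p] is a fixed
    linear function of the error made by an approximating [v]. *)
Lemma range_closed (I : finType) (a : I -> V) (xi : I -> R) :
  (forall i, D (a i)) ->
  (forall eps, 0 < eps -> exists2 v, D v &
     forall p, `|dot v (a p) - xi p| < eps) ->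
  exists2 w, D w & forall p, dot w (a p) = xi p.
Proof.
move=> Da apx; have [H HP] := gram_projection Da.
exists (\sum_q (\sum_r H q r * xi r) *: a q).
  by apply: Dsum => q; exact: DZ.
move=> p; apply/eqP; rewrite -subr_eq0 -normr_eq0.
pose C := \sum_q (\sum_r `|H q r|) * `|dot (a q) (a p)|.
have C0 : 0 <= C by apply: sumr_ge0 => q _; rewrite mulr_ge0// sumr_ge0.
rewrite eq_le normr_ge0 andbT; apply/ler_addgt0Pr => e e0; rewrite add0r.
have eC : 0 < e / (C + 1) by rewrite divr_gt0// ltr_wpDl.
have [v Dv va] := apx _ eC.
rewrite -(subrKA (dot v (a p))) (le_trans (ler_normD _ _))//.
rewrite -{1}(HP v Dv p) !si_suml// -sumrB.
have -> : e = C * (e / (C + 1)) + e / (C + 1).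
  by field; rewrite gt_eqF// ltr_wpDl.
rewrite lerD ?(ltW (va _))//.
rewrite (le_trans (ler_norm_sum _ _ _))// /C mulr_suml ler_sum// => q _.
rewrite -mulrBl -sumrB normrM mulrAC ler_wpM2r//.
rewrite (le_trans (ler_norm_sum _ _ _))// mulr_suml ler_sum// => r _.
by rewrite -mulrBr normrM ler_wpM2l// distrC ltW.
Qed.

(** Convergence of the method of simultaneous projections.  The vector [p k i]
    is the orthogonal projection of [e k] onto the span of the [a i j]; it is
    characterized by the two conditions on it, up to null vectors, which is why
    the recursion is also only required up to a null vector.  The limit is the
    component [h] of [e 0] in the common kernel, and the squared distance to it
    decreases at least geometrically. *)
Lemma cimmino (I J : finType) (a : I -> J -> V) (lam : I -> R)
    (e : nat -> V) (p : nat -> I -> V) :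
  (forall i j, D (a i j)) ->
  (forall i, 0 < lam i) -> \sum_i lam i = 1 ->
  (forall k, D (e k)) -> (forall k i, D (p k i)) ->
  (forall k i j, dot (p k i) (a i j) = dot (e k) (a i j)) ->
  (forall k i h, D h -> (forall j, dot h (a i j) = 0) -> dot (p k i) h = 0) ->
  (forall k, let d := e k.+1 - (e k - \sum_i lam i *: p k i) in
             dot d d = 0) ->
  exists h, [/\ D h, forall i j, dot h (a i j) = 0 &
    (fun k => Num.sqrt (dot (e k - h) (e k - h))) @ \oo --> (0 : R)].
Proof.
move=> Da lam0 lam1 De Dp pa pker step.
pose b (q : I * J) := a q.1 q.2.
have Db q : D (b q) by exact: Da.
have [H HP] := gram_projection Db.
pose proj v := \sum_q (\sum_r H q r * dot v (b r)) *: b q.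
have Dproj v : D (proj v) by apply: Dsum => q; exact: DZ.
have projker v q : D v -> dot (v - proj v) (b q) = 0.
  by move=> Dv; rewrite si_Bl// HP// subrr.
pose h := e 0%N - proj (e 0%N).
have Dh : D h by exact: si_memB.
pose f k := e k - h.
have Df k : D (f k) by exact: si_memB.
pose s k := \sum_i lam i *: p k i.
have Ds k : D (s k) by apply: Dsum => i; exact: DZ.
pose d k := e k.+1 - (e k - s k).
have Dd k : D (d k) by apply: si_memB => //; exact: si_memB.
have fS k : f k.+1 = (f k - s k) + d k.
  by rewrite /f /d -[e k - h - s k]addrAC [RHS]addrC subrKA.
(* The whole sequence [f] stays orthogonal to the common kernel. *)
have fperp k v : D v -> (forall q, dot v (b q) = 0) -> dot (f k) v = 0.
  move=> Dv vb; elim: k => [|k IH].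
    rewrite /f /h opprB addrCA subrr addr0 si_suml// big1// => q _.
    by rewrite (si_sym dotP)// vb mulr0.
  rewrite fS (si_addl dotP)//; last exact: si_memB.
  rewrite si_Bl// IH si_suml// big1 ?subr0 ?add0r.
    rewrite (si_sym dotP)//; apply: null_orthogonal => //; exact: step.
  by move=> i _; rewrite pker ?mulr0// => j; rewrite -(vb (i, j)).
have pf k i : dot (p k i) (f k) = dot (p k i) (p k i).
  apply/eqP; rewrite -subr_eq0 -si_Br//; apply/eqP/pker.
    exact: si_memB.
  move=> j; rewrite si_Bl// pa /f si_Bl//.
  by rewrite (projker _ (i, j))// subr0 subrr.
pose E k := \sum_i lam i * dot (p k i) (p k i).
(* One step gains the energy [E k]: expand the square and bound the second
   order term by convexity. *)
have fE k : dot (f k.+1) (f k.+1) <= dot (f k) (f k) - E k.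
  have dd : dot (d k) (d k) = 0 by exact: step.
  have Dfs : D (f k - s k) by exact: si_memB.
  rewrite fS.
  have -> : dot (f k - s k + d k) (f k - s k + d k) =
      dot (f k - s k) (f k - s k).
    have := null_orthogonal Dfs (Dd k) dd; move: Dfs (Dd k) dd.
    move: (f k - s k) (d k) => g g' Dg Dg' g'0 gg'.
    rewrite (si_addl dotP Dg Dg'); last exact: DD.
    by rewrite !si_addr// g'0 (si_sym dotP Dg')// gg' !addr0.
  rewrite sqnormB//.
  have -> : dot (s k) (f k) = E k.
    by rewrite si_suml//; apply: eq_bigr => i _; rewrite pf.
  have := @convex_sqnorm I lam (p k) (Dp k) (fun i => ltW (lam0 i)) lam1.
  rewrite -/(s k) -/(E k) /=; lra.
pose M := \sum_i \sum_j dot (a i j) (a i j) / lam i.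
pose h1 := \sum_q \sum_r `|H q r|.
have M0 : 0 <= M.
  by apply: sumr_ge0 => i _; apply: sumr_ge0 => j _; rewrite divr_ge0//
     ?(si_ge0 dotP)// ltW.
have h10 : 0 <= h1 by apply: sumr_ge0 => q _; exact: sumr_ge0.
have E0 k : 0 <= E k.
  by apply: sumr_ge0 => i _; rewrite mulr_ge0 ?(si_ge0 dotP)// ltW.
pose Y k := \sum_q dot (f k) (b q) ^+ 2.
have YE k : Y k <= M * E k.
  rewrite /Y -(pair_bigA _ (fun i j => dot (f k) (a i j) ^+ 2))/=.
  rewrite mulr_suml ler_sum// => i _.
  rewrite mulr_suml ler_sum// => j _.
  have -> : dot (f k) (a i j) = dot (p k i) (a i j).
    by rewrite pa si_Bl// (projker _ (i, j))// subr0.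
  apply: (le_trans (cauchy_schwarz _ _)) => //.
  rewrite -mulrA mulrC ler_wpM2l ?(si_ge0 dotP)//.
  rewrite ler_pdivlMl// /E (bigD1 i)//= lerDl sumr_ge0// => l _.
  by rewrite mulr_ge0 ?(si_ge0 dotP)// ltW.
(* Coercivity: as [f k] is orthogonal to the kernel, its square is
   [dot (f k) (proj (f k))], a fixed quadratic form in the numbers
   [dot (f k) (b q)]. *)
have fY k : dot (f k) (f k) <= h1 * Y k.
  have -> : dot (f k) (f k) = dot (f k) (proj (f k)).
    apply/eqP; rewrite -subr_eq0 -si_Br//; apply/eqP/fperp.
      exact: si_memB.
    by move=> q; exact: projker.
  have yY q : dot (f k) (b q) ^+ 2 <= Y k.
    rewrite /Y (bigD1 q)//= lerDl sumr_ge0// => *; exact: sqr_ge0.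
  rewrite si_sumr// mulr_suml ler_sum// => q _.
  rewrite !mulr_suml ler_sum// => r _.
  rewrite -mulrA (le_trans (ler_norm _))// normrM ler_wpM2l//.
  have := yY q; have := yY r; move: (dot _ _) (dot _ _) => x y xY yY'.
  rewrite ler_norml; have := sqr_ge0 (x - y); have := sqr_ge0 (x + y).
  by rewrite sqrrD sqrrB => ? ?; apply/andP; split; nra.
(* Adding 1 makes [C >= 1], so that the ratio [r] is in [0, 1). *)
pose C := h1 * M + 1.
have C1 : 1 <= C by rewrite /C lerDr mulr_ge0.
have C0 : 0 < C by exact: lt_le_trans C1.
pose r := 1 - C^-1.
have r0 : 0 <= r by rewrite subr_ge0 invf_le1.
have r1 : r < 1 by rewrite ltrBlDr ltrDl invr_gt0.
have decay k : dot (f k) (f k) <= dot (f 0%N) (f 0%N) * r ^+ k.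
  elim: k => [|k IH]; first by rewrite expr0 mulr1.
  have fCE : dot (f k) (f k) <= C * E k.
    rewrite (le_trans (fY k))// (le_trans (ler_wpM2l h10 (YE k)))//.
    by rewrite /C mulrDl mul1r mulrA lerDl.
  rewrite exprSr mulrA (le_trans (fE k))//.
  apply: (@le_trans _ _ (dot (f k) (f k) * r)); last exact: ler_wpM2r.
  by rewrite /r mulrBr mulr1 lerB// ler_pdivrMr// mulrC.
exists h; split => //; first by move=> i j; exact: (projker _ (i, j)).
rewrite -sqrtr0; apply: continuous_cvg; first exact: sqrt_continuous.
apply: (@squeeze_cvgr _ _ _ _ (fun=> 0)
  (fun k => dot (f 0%N) (f 0%N) * r ^+ k)).
- by near=> k; rewrite (si_ge0 dotP (Df k)) decay.
- exact: cvg_cst.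
- rewrite -[X in _ --> X](mulr0 (dot (f 0%N) (f 0%N))).
  apply: cvgMr; apply: cvg_expr; by rewrite ger0_norm.
Unshelve. all: by end_near. Qed.

(** A map of finite rank takes the same values on a dense subspace [P] as on
    the whole of [D], since a dense subspace of a finite-dimensional space is
    everything.  Density is expressed by its dual form: only null vectors are
    orthogonal to [P]. *)
Lemma dense_interpolation (P : V -> Prop) (I : finType) (a : I -> V) (v : V) :
  (forall u, P u -> D u) -> P 0 -> (forall u w, P u -> P w -> P (u + w)) ->
  (forall c u, P u -> P (c *: u)) ->
  (forall z, D z -> (forall u, P u -> dot u z = 0) -> dot z z = 0) ->
  (forall i, D (a i)) -> D v ->
  exists2 u, P u & forall i, dot u (a i) = dot v (a i).
Proof.
move=> PD P0 PDD PZ dense Da Dv.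
pose ev w : 'rV[R]_#|I| := \row_j dot w (a (enum_val j)).
pose W y := exists2 u, P u & ev u = y.
suff [u Pu /rowP uv] : W (ev v).
  exists u => // i; have := uv (enum_rank i).
  by rewrite !mxE enum_rankK.
apply: subspace_orthogonal.
- by exists 0 => //; apply/rowP => j; rewrite !mxE si_0l.
- move=> _ _ [u Pu <-] [w Pw <-]; exists (u + w); first exact: PDD.
  by apply/rowP => j; rewrite !mxE (si_addl dotP)//; exact: PD.
- move=> c _ [u Pu <-]; exists (c *: u); first exact: PZ.
  by apply/rowP => j; rewrite !mxE (si_scalel dotP)//; exact: PD.
move=> z zW.
pose b := \sum_j z j 0 *: a (enum_val j).
have Db : D b by apply: Dsum => j; exact: DZ.
have evz w : D w -> (ev w *m z) 0 0 = dot w b.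
  move=> Dw; rewrite si_sumr// mxE; apply: eq_bigr => j _.
  by rewrite mxE mulrC.
apply/matrixP => i j; rewrite (ord1 i) (ord1 j) evz// mxE.
apply: null_orthogonal => //; apply: dense => // u Pu.
by rewrite -evz ?zW ?mxE//; [exists u|exact: PD].
Qed.

End SemiInner.

(** * Absolutely continuous functions *)

Lemma le_double_sum (R : numDomainType) m n (F : 'I_m -> 'I_n -> R) i j :
  (forall i j, 0 <= F i j) -> F i j <= \sum_i \sum_j F i j.
Proof.
move=> F0; rewrite (bigD1 i)//= (bigD1 j)//= -addrA lerDl addr_ge0//.
  by apply: sumr_ge0 => ? _.
by do 2 (apply: sumr_ge0 => ? _).
Qed.

Section AbsolutelyContinuous.
Context (R : realType).
Notation mu := (@lebesgue_measure R).
Implicit Types (f g : R -> R) (a b : R).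

Lemma ae_imp (P Q : R -> Prop) : (forall t, P t -> Q t) ->
  {ae mu, forall t, P t} -> {ae mu, forall t, Q t}.
Proof. by apply: filterS; exact: (ae_filter_ringOfSetsType mu). Qed.

Lemma ae_imp2 (P Q S : R -> Prop) : (forall t, P t -> Q t -> S t) ->
  {ae mu, forall t, P t} -> {ae mu, forall t, Q t} -> {ae mu, forall t, S t}.
Proof. by apply: filterS2; exact: (ae_filter_ringOfSetsType mu). Qed.

Lemma ae_forall (I : finType) (P : I -> R -> Prop) :
  (forall i, {ae mu, forall t, P i t}) -> {ae mu, forall t, forall i, P i t}.
Proof. by apply: filter_forall; exact: (ae_filter_ringOfSetsType mu). Qed.

Lemma lebesgue_null_cover (Z : set R) (d : R) : mu.-negligible Z -> 0 < d ->
  exists U, [/\ open U, Z `<=` U & (mu U < d%:E)%E].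
Proof.
move=> [N [mN N0 ZN]] d0.
have [|U [oU NU Ud]] := lebesgue_regularity_outer mN _ d0.
  by rewrite [ltLHS]N0.
exists U; split => //; first exact: subset_trans NU.
have mU : measurable U by exact: open_measurable.
rewrite -(setDUK NU) measureU//.
- by rewrite [X in (X + _)%E]N0 add0e.
- exact: measurableD.
- exact: setDIK.
Qed.

Lemma lebesgue_disjoint_itv (k : nat) (p q : 'I_k -> R) :
  (forall i, p i <= q i) -> trivIset setT (fun i => [set` `]p i, q i[]) ->
  mu (\big[setU/set0]_(i < k) [set` `]p i, q i[]) = (\sum_i (q i - p i))%:E.
Proof.
move=> pq triv; rewrite measure_semi_additive_ord//; last first.
  exact: bigsetU_measurable.
rewrite -sumEFin; apply: eq_bigr => i _.
rewrite [LHS]lebesgue_measure_itv/= lte_fin; case: ltP => // qp.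
by congr EFin; apply/eqP; rewrite eq_sym subr_eq0 eq_le qp pq.
Qed.

Lemma disjoint_itv_length (U : set R) (k : nat) (p q : 'I_k -> R) (d : R) :
  measurable U -> (mu U < d%:E)%E ->
  (forall i, p i <= q i) -> trivIset setT (fun i => [set` `]p i, q i[]) ->
  (forall i, [set` `]p i, q i[] `<=` U) ->
  \sum_i (q i - p i) < d.
Proof.
move=> mU Ud pq triv sub; rewrite -lte_fin (le_lt_trans _ Ud)//.
rewrite -lebesgue_disjoint_itv//; apply: le_measure; rewrite ?inE//.
  exact: bigsetU_measurable.
elim/big_ind : _ => // A B AU BU.
by rewrite subUset.
Qed.

(** Cousin's argument.  Let [d] be the modulus of absolute continuity for [e']
    and [U] an open set of measure less than [d] around the points without a
    nonpositive derivative.  Near any other point, [f] increases by at most [e']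
    times the length of an interval around it.  Chaining such intervals with
    intervals inside [U], from [a] up to [b], the former contribute at most
    [e' * (b - a)] and the latter, being disjoint and of total length less than
    [d], at most [e']. *)
Lemma ac_nonincreasing f a b : a <= b -> absolutely_continuous_on a b f ->
  {ae mu, forall t, a < t < b -> exists2 d, d <= 0 & is_derive t (1 : R) f d} ->
  f b <= f a.
Proof.
move=> ab acf fd; rewrite -subr_le0; apply/ler_addgt0Pr => e e0; rewrite add0r.
(* Both contributions together, [e' * (b - a) + e'], make [e]. *)
pose e' := e / (b - a + 1).
have ba1 : 0 < b - a + 1 by rewrite ltr_wpDl// subr_ge0.
have e'0 : 0 < e' by rewrite divr_gt0.
have [d d0 acd] := acf _ e'0.
pose good t := exists2 d, d <= 0 & is_derive t (1 : R) f d.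
(* The endpoints have no prescribed derivative either, hence belong to [Z]. *)
pose Z := ~` [set t | a < t < b -> good t] `|` ([set a] `|` [set b]).
have nZ : mu.-negligible Z.
  apply: negligibleU; first exact: fd.
  by apply: negligibleU; apply/negligibleP => //; exact: lebesgue_measure_set1.
have [U [oU ZU Ud]] := lebesgue_null_cover nZ d0.
(* [Q x]: the chain can be built up to [x]; the [k] intervals are those taken
   inside [U]. *)
pose Q x := exists k (p q : 'I_k -> R),
  [/\ forall i, a <= p i /\ p i <= q i /\ q i <= x,
      trivIset setT (fun i => [set` `]p i, q i[]),
      forall i, [set` `]p i, q i[] `<=` U &
      f x - f a <= e' * (x - a) + \sum_i (f (q i) - f (p i))].
have QS y z : a <= y -> y <= z -> Q y ->
    ([set` `]y, z[] `<=` U \/ f z - f y <= e' * (z - y)) -> Q z.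
  move=> ay yz [k [p [q [pq triv sub fy]]]] [yzU|fzy]; last first.
    exists k, p, q; split => //.
      by move=> i; have [? [? qy]] := pq i; split => //; split=> //; lra.
    lra.
  pose ext (r : 'I_k -> R) w (i : 'I_k.+1) := oapp r w (unlift ord_max i).
  have extm r w : ext r w ord_max = w by rewrite /ext unlift_none.
  have extl r w i : ext r w (widen_ord (leqnSn k) i) = r i.
    rewrite /ext (_ : widen_ord _ i = lift ord_max i) ?liftK//.
    by apply: val_inj; rewrite /= /bump leqNgt ltn_ord.
  exists k.+1, (ext p y), (ext q z); split.
  - move=> i; rewrite /ext; case: unliftP => [j _|_]/=; last first.
      by split=> //; split.
    by have [? [? qy]] := pq j; split => //; split => //; lra.
  - apply/trivIsetP => i j _ _ ij.
    move/trivIsetP : triv => /(_ _ _ I I) triv.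
    rewrite /ext; case: unliftP => [i' Ei|Ei]/=;
      case: unliftP => [j' Ej|Ej]/=.
    + by apply: triv; apply: contra_neq ij => ij'; rewrite Ei Ej ij'.
    + apply/seteqP; split => // x []/=; rewrite !in_itv/= => xi xy.
      by have := pq i'; lra.
    + apply/seteqP; split => // x []/=; rewrite !in_itv/= => xi xy.
      by have := pq j'; lra.
    + by move: ij; rewrite Ei Ej eqxx.
  - by move=> i; rewrite /ext; case: unliftP => [j _|_]/=; [exact: sub|].
  - rewrite big_ord_recr/= !extm.
    under eq_bigr do rewrite !extl.
    move: fy; move: (\sum_i _) => s fy.
    have : 0 <= e' * (z - y) by rewrite mulr_ge0 ?subr_ge0// ltW.
    lra.
have Qa : Q a.
  exists 0%N, (fun=> 0), (fun=> 0); split => //; try by case.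
  by rewrite big_ord0 !subrr mulr0 addr0.
have Qend : Q b -> f b - f a <= e.
  move=> [k [p [q [pq triv sub fb]]]].
  have : \sum_i `|f (q i) - f (p i)| < e'.
    apply: acd => //.
    apply: (@disjoint_itv_length U) => //; first exact: open_measurable.
    by move=> i; have [? []] := pq i.
  have : \sum_i (f (q i) - f (p i)) <= \sum_i `|f (q i) - f (p i)|.
    by apply: ler_sum => i _; exact: ler_norm.
  have : e = e' * (b - a) + e' by rewrite /e'; field; rewrite gt_eqF.
  lra.
apply: Qend.
(* Real induction: the supremum [c] of the points that can be reached is itself
   an interior point of the next step, unless it is [b]. *)
pose S := [set x | a <= x <= b /\ Q x].
have Sa : S a by split => //; rewrite lexx ab.
have hS : has_sup S by split; [exists a|exists b => x [/andP[]]].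
pose c := sup S.
have ac : a <= c by apply: ub_le_sup => //; case: hS.
have cb : c <= b by apply: ge_sup => // [|x [/andP[]//]]; exists a.
have [r r0 step] : exists2 r, 0 < r & forall y z, a <= y -> z <= b ->
    y <= c <= z -> c - r < y -> z < c + r -> Q y -> Q z.
  have [cU|ncU] := pselect (U c).
    have /nbhs_ballP[r /= r0 rU] : nbhs c U by exact: open_nbhs_nbhs.
    exists r => // y z ay zb /andP[yc cz] cy zc Qy.
    apply: (QS y) => //; first lra.
    left => x /=; rewrite in_itv/= => xyz; apply: rU.
    by rewrite /ball/= ltr_norml; lra.
  have [m m0 dm] : good c.
    apply: contrapT => ngc; apply: ncU; apply: ZU.
    have [->|ca] := eqVneq c a; first by right; left.
    have [->|cb'] := eqVneq c b; first by right; right.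
    left => /= /(_ _) gc; apply: ngc; apply: gc.
    by rewrite !lt_neqAle eq_sym ca ac cb' cb.
  have [dc Dc] := dm.
  have /cvg_ex[l cvl] := dc.
  have ml : l = m by rewrite -Dc; apply/esym/cvg_lim.
  rewrite {}ml in cvl.
  move/cvgrPdist_lt : cvl => /(_ _ e'0) [r /= r0 rP].
  exists r => // y z ay zb /andP[yc cz] cy zc Qy.
    apply: (QS y) => //; first lra.
  right.
  have est h : `|h| < r -> h != 0 -> h^-1 * (f (h + c) - f c) < e'.
    move=> hr h0.
    have := rP h; rewrite /ball_/= sub0r normrN => /(_ hr h0).
    rewrite /GRing.scale/= mulr1 ltr_norml => /andP[+ _].
    lra.
  have zc' : f z - f c <= e' * (z - c).
    have [->|zc0] := eqVneq z c; first by rewrite !subrr mulr0.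
    have hz : 0 < z - c by rewrite subr_gt0 lt_neqAle eq_sym zc0 cz.
    have := est (z - c); rewrite gtr0_norm// subrK => /(_ _ _)/ltW.
    rewrite mulrC ler_pdivrMr//; apply; first lra.
    by rewrite gt_eqF.
  have yc' : f c - f y <= e' * (c - y).
    have [->|yc0] := eqVneq y c; first by rewrite !subrr mulr0.
    have hy : 0 < c - y by rewrite subr_gt0 lt_neqAle yc0 yc.
    have := est (y - c); rewrite distrC gtr0_norm// subrK => /(_ _ _)/ltW.
    rewrite -(opprB c y) invrN mulNr -mulrN mulrC ler_pdivrMr//.
    rewrite -[f c - f y]opprB.
    by apply; [lra|rewrite oppr_eq0 gt_eqF].
  lra.
have [y [/andP[ay yb] Qy] cy] := sup_adherent r0 hS.
have yc : y <= c by apply: ub_le_sup; [case: hS|split => //; rewrite ay].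
pose z := Num.min b (c + r / 2).
have cz : c <= z by rewrite /z le_min cb lerDl; lra.
have zb : z <= b by rewrite /z ge_min lexx.
have zc : z < c + r by rewrite /z gt_min; apply/orP; right; lra.
have Qz : Q z by apply: (step y z) => //; rewrite yc cz.
have : z <= c.
  by apply: ub_le_sup; [case: hS|split => //; rewrite zb (le_trans ac)].
rewrite {1}/z ge_min => /orP[bc|]; last lra.
by rewrite (_ : b = z)//; apply/eqP; rewrite eq_le zb (le_trans bc).
Qed.


Lemma ac_subitv (V : normedModType R) (f : R -> V) a b c d :
  a <= c -> d <= b ->
  absolutely_continuous_on a b f -> absolutely_continuous_on c d f.
Proof.
move=> ac db acf e /acf[r r0 fr]; exists r => // k p q pq; apply: fr => i.
have [cp [? qd]] := pq i; split.
  exact: le_trans cp.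
by split=> //; exact: le_trans db.
Qed.

Lemma lipschitz_ac (V : normedModType R) (f : R -> V) a b (C : R) :
  (forall x y, a <= x -> x <= y -> y <= b -> `|f y - f x| <= C * (y - x)) ->
  absolutely_continuous_on a b f.
Proof.
move=> fC e e0; pose C' := `|C| + 1.
have C'0 : 0 < C' by rewrite ltr_wpDl.
exists (e / C') => [|k p q pq _ sd]; first by rewrite divr_gt0.
rewrite (@le_lt_trans _ _ (C' * \sum_i (q i - p i)))//.
  rewrite mulr_sumr ler_sum// => i _; have [ap [pqi qb]] := pq i.
  rewrite (le_trans (fC _ _ ap pqi qb))// ler_wpM2r ?subr_ge0//.
  by rewrite (le_trans (ler_norm C))// lerDl.
by rewrite mulrC -ltr_pdivlMr.
Qed.

Lemma le_ac (V W : normedModType R) (f : R -> V) (g : R -> W) a b (C : R) :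
  (forall x y, a <= x -> x <= y -> y <= b ->
     `|f y - f x| <= C * `|g y - g x|) ->
  absolutely_continuous_on a b g -> absolutely_continuous_on a b f.
Proof.
move=> fC acg e e0; pose C' := `|C| + 1.
have C'0 : 0 < C' by rewrite ltr_wpDl.
have [|d d0 gd] := acg (e / C'); first by rewrite divr_gt0.
exists d => // k p q pq triv sd.
rewrite (@le_lt_trans _ _ (C' * \sum_i `|g (q i) - g (p i)|))//.
  rewrite mulr_sumr ler_sum// => i _; have [ap [pqi qb]] := pq i.
  rewrite (le_trans (fC _ _ ap pqi qb))// ler_wpM2r//.
  by rewrite (le_trans (ler_norm C))// lerDl.
by rewrite mulrC -ltr_pdivlMr//; exact: gd.
Qed.

Lemma le_acD (V W U : normedModType R) (f : R -> V) (g : R -> W) (h : R -> U)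
    a b (C : R) :
  (forall x y, a <= x -> x <= y -> y <= b ->
     `|f y - f x| <= C * (`|g y - g x| + `|h y - h x|)) ->
  absolutely_continuous_on a b g -> absolutely_continuous_on a b h ->
  absolutely_continuous_on a b f.
Proof.
move=> fC acg ach e e0; pose C' := `|C| + 1.
have C'0 : 0 < C' by rewrite ltr_wpDl.
have eC : 0 < e / C' / 2 by rewrite !divr_gt0.
have [d1 d10 gd] := acg _ eC.
have [d2 d20 hd] := ach _ eC.
exists (Num.min d1 d2) => [|k p q pq triv].
  by rewrite lt_min d10.
rewrite lt_min => /andP[sd1 sd2].
rewrite (@le_lt_trans _ _ (C' * \sum_i (`|g (q i) - g (p i)| +
   `|h (q i) - h (p i)|)))//.
  rewrite mulr_sumr ler_sum// => i _; have [ap [pqi qb]] := pq i.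
  rewrite (le_trans (fC _ _ ap pqi qb))// ler_wpM2r// ?addr_ge0//.
  by rewrite (le_trans (ler_norm C))// lerDl.
rewrite mulrC -ltr_pdivlMr// big_split/= (splitr (e / C')).
by rewrite ltrD//; [exact: gd|exact: hd].
Qed.

Lemma ac_cst (V : normedModType R) (v : V) a b :
  absolutely_continuous_on a b (cst v : R -> V).
Proof.
by apply: (@lipschitz_ac _ _ _ _ 0) => x y _ _ _; rewrite /= subrr normr0 mul0r.
Qed.

Lemma acD (V : normedModType R) (f g : R -> V) a b :
  absolutely_continuous_on a b f -> absolutely_continuous_on a b g ->
  absolutely_continuous_on a b (fun t => f t + g t).
Proof.
apply: (@le_acD _ _ _ _ _ _ _ _ 1) => x y _ _ _.
by rewrite mul1r opprD addrACA ler_normD.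
Qed.

Lemma ac_sum (V : normedModType R) (I : Type) (r : seq I) (f : I -> R -> V)
    a b : (forall i, absolutely_continuous_on a b (f i)) ->
  absolutely_continuous_on a b (fun t => \sum_(i <- r) f i t).
Proof.
move=> acf; elim: r => [|i r IH].
  under eq_fun do rewrite big_nil; exact: ac_cst.
under eq_fun do rewrite big_cons.
exact: (acD (acf i) IH).
Qed.

Lemma acN (V : normedModType R) (f : R -> V) a b :
  absolutely_continuous_on a b f ->
  absolutely_continuous_on a b (fun t => - f t).
Proof.
by apply: (@le_ac _ _ _ _ _ _ 1) => x y _ _ _; rewrite mul1r -opprD normrN.
Qed.

Lemma ac_small (V : normedModType R) (f : R -> V) a b (e : R) :
  absolutely_continuous_on a b f -> 0 < e -> exists2 d, 0 < d &
  forall s t, a <= s -> s <= t -> t <= b -> t - s < d -> `|f t - f s| < e.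
Proof.
move=> acf e0; have [d d0 fd] := acf e e0; exists d => // s t as_ st tb std.
have := fd 1%N (fun=> s) (fun=> t).
rewrite !big_ord1; apply => //.
by move=> i j _ _ _; rewrite (ord1 i) (ord1 j).
Qed.

Lemma ac_within_continuous (V : normedModType R) (f : R -> V) a b :
  absolutely_continuous_on a b f -> {within `[a, b], continuous f}.
Proof.
move=> acf; apply/subspace_continuousP => x.
rewrite /= in_itv/= => /andP[ax xb].
apply/cvgrPdist_lt => e e0; have [d d0 small] := ac_small acf e0.
rewrite near_withinE; near=> y; rewrite /= in_itv/= => /andP[ay yb].
have xyd : `|x - y| < d by near: y; exact: (@nbhsx_ballx _ _ x d d0).
have [xy|yx] := leP x y.
  by rewrite distrC small//; move: xyd; rewrite distrC ger0_norm ?subr_ge0.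
by rewrite small ?(ltW yx)//; move: xyd; rewrite gtr0_norm ?subr_gt0.
Unshelve. all: by end_near. Qed.

Lemma ac_bounded (V : normedModType R) (f : R -> V) a b :
  absolutely_continuous_on a b f ->
  exists C, forall t, a <= t <= b -> `|f t| <= C.
Proof.
move=> /ac_within_continuous fc.
have := continuous_compact fc (@segment_compact _ a b).
move=> /compact_bounded[M [_ fM]]; exists (M + 1) => t tab.
by apply: (fM (M + 1)); [rewrite ltrDl|exists t => //=; rewrite in_itv].
Qed.

Lemma acM f g a b :
  absolutely_continuous_on a b f -> absolutely_continuous_on a b g ->
  absolutely_continuous_on a b (fun t => f t * g t).
Proof.
move=> acf acg; have [C fC] := ac_bounded acf; have [D gD] := ac_bounded acg.
move: acf acg; apply: (@le_acD _ _ _ _ _ _ _ _ (Num.max C D)).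
move=> x y ax xy yb.
have -> : f y * g y - f x * g x = (f y - f x) * g y + f x * (g y - g x).
  ring.
rewrite (le_trans (ler_normD _ _))// !normrM mulrDr lerD//.
  by rewrite mulrC ler_wpM2r// le_max gD ?orbT// yb (le_trans ax).
by rewrite ler_wpM2r// le_max fC// ax (le_trans xy).
Qed.

Lemma entry_le_mx_norm m n (M : 'M[R]_(m, n)) i j : `|M i j| <= `|M|.
Proof.
rewrite [leRHS]/Num.Def.normr/= mx_normrE.
exact: (le_bigmax _ (fun ij => `|M ij.1 ij.2|) (i, j)).
Qed.

Lemma ac_mxP m n (M : R -> 'M[R]_(m, n)) a b :
  absolutely_continuous_on a b M <->
  forall i j, absolutely_continuous_on a b (fun t => M t i j).
Proof.
split=> [acM i j|acM].
  apply: (@le_ac _ _ _ _ _ _ 1 _ acM) => x y _ _ _.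
  by rewrite mul1r; have := entry_le_mx_norm (M y - M x) i j; rewrite !mxE.
have : absolutely_continuous_on a b
    (fun t => \sum_i \sum_j M t i j *: delta_mx i j).
  apply: ac_sum => i; apply: ac_sum => j.
  apply: (@le_ac _ _ _ _ _ _ `|delta_mx i j : 'M[R]_(m, n)| _ (acM i j)).
  by move=> x y _ _ _; rewrite -scalerBl normrZ mulrC.
by congr absolutely_continuous_on; apply/funext => t; rewrite -matrix_sum_delta.
Qed.

Lemma ac_mulmx m n p (M : R -> 'M[R]_(m, n)) (N : R -> 'M[R]_(n, p)) a b :
  absolutely_continuous_on a b M -> absolutely_continuous_on a b N ->
  absolutely_continuous_on a b (fun t => M t *m N t).
Proof.
move=> /ac_mxP cM /ac_mxP cN; apply/ac_mxP => i j.
under eq_fun do rewrite mxE.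
apply: (@ac_sum _ _ _ (fun k t => M t i k * N t k j)) => k.
exact: (acM (cM i k) (cN k j)).
Qed.

Lemma is_derive_mxP m n (M : R -> 'M[R]_(m, n)) (D : 'M[R]_(m, n)) (t : R) :
  is_derive t (1 : R) M D <->
  forall i j, is_derive t (1 : R) (fun s => M s i j) (D i j).
Proof.
split=> [[dM <-] i j|dM].
  split; first by move/derivable_mxP : dM.
  by rewrite derive_mx// mxE.
have d : derivable M t 1 by apply/derivable_mxP => i j; case: (dM i j).
split => //; rewrite derive_mx//; apply/matrixP => i j; rewrite mxE.
by case: (dM i j).
Qed.

Lemma is_derive_sum_fun (I : Type) (r : seq I) (f : I -> R -> R) (df : I -> R)
    (t : R) : (forall i, is_derive t (1 : R) (f i) (df i)) ->
  is_derive t (1 : R) (fun s => \sum_(i <- r) f i s) (\sum_(i <- r) df i).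
Proof.
move=> fd; elim: r => [|i r IH].
  under eq_fun do rewrite big_nil; rewrite big_nil; exact: is_derive_cst.
under eq_fun do rewrite big_cons; rewrite big_cons; exact: is_deriveD.
Qed.

Lemma is_derive_mulmx m n p (M : R -> 'M[R]_(m, n)) (N : R -> 'M[R]_(n, p))
    dM dN (t : R) :
  is_derive t (1 : R) M dM -> is_derive t (1 : R) N dN ->
  is_derive t (1 : R) (fun s => M s *m N s) (dM *m N t + M t *m dN).
Proof.
move=> /is_derive_mxP dMt /is_derive_mxP dNt; apply/is_derive_mxP => i j.
under eq_fun do rewrite mxE.
rewrite !mxE -big_split/=; apply: is_derive_sum_fun => k.
apply: (is_derive_eq (is_deriveM (dMt i k) (dNt k j))).
by rewrite /GRing.scale/=; ring.
Qed.

End AbsolutelyContinuous.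

(** * Primitives of Lebesgue integrable functions *)

Section Primitive.
Context (R : realType).
Notation mu := (@lebesgue_measure R).
Implicit Types (f g : R -> R) (a b : R).

Lemma primitive_itvB g a p q : mu.-integrable setT (EFin \o g) ->
  a <= p -> p <= q ->
  \int[mu]_(t in `[a, q]) g t - \int[mu]_(t in `[a, p]) g t =
  \int[mu]_(t in `]p, q]) g t.
Proof.
move=> ig ap pq; rewrite Rintegral_itvB ?bnd_simp//.
exact: integrableS ig.
Qed.

(** The integral of [|g|] over a set of small measure is small; apply this to
    the union of the given disjoint intervals. *)
Lemma primitive_ac g a b : mu.-integrable setT (EFin \o g) ->
  absolutely_continuous_on a b (fun t => \int[mu]_(s in `[a, t]) g s).
Proof.
move=> ig e e0; have [d [d0 gd]] := integral_normr_continuous ig e0.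
exists d => // k p q pq triv sd.
have ign : mu.-integrable setT (EFin \o (fun x => `|g x|)).
  exact: (integrable_norm ig).
pose W := \big[setU/set0]_(i < k) [set` `]p i, q i[].
have mW : measurable W by exact: bigsetU_measurable.
have Wd : (mu W < d%:E)%E.
  by rewrite /W lebesgue_disjoint_itv ?lte_fin// => i; have [_ []] := pq i.
rewrite (le_lt_trans _ (gd W mW Wd))//.
have ignS (D : set R) : measurable D ->
    mu.-integrable D (EFin \o (fun x => `|g x|)).
  by move=> mD; exact: integrableS ign.
have -> : \int[mu]_(x in W) `|g x| = \sum_i \int[mu]_(x in `]p i, q i[) `|g x|.
  apply: EFin_inj; rewrite -sumEFin.
  rewrite /Rintegral fineK; last first.
    by apply: integrable_fin_num => //; exact: ignS.
  rewrite ge0_integral_bigsetU//=.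
  - apply: eq_bigr => i _; rewrite fineK//.
    by apply: integrable_fin_num => //; exact: ignS.
  - exact: index_enum_uniq.
  - by apply: sub_trivIset triv.
  - exact: (measurable_int mu (ignS _ mW)).
apply: ler_sum => i _; have [ap [pqi qb]] := pq i.
rewrite primitive_itvB//.
rewrite (le_trans (le_normr_Rintegral _ _))//; first exact: integrableS ig.
by rewrite Rintegral_itv_bndo_bndc//; exact: ignS.
Qed.

Lemma primitive_derive g a : mu.-integrable setT (EFin \o g) ->
  {ae mu, forall t, a < t ->
    is_derive t (1 : R) (fun t => \int[mu]_(s in `[a, t]) g s) (g t)}.
Proof.
move=> ig.
have := @FTC1 R g (BLeft a)
  (fun y => integrableS measurableT _ (@subsetT _ _) ig).
move=> /(_ _)/[dup].
have lg : locally_integrable setT g.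
  have := integrable_locally measurableT ig.
  by rewrite patch_setT.
move=> /(_ (fun y => measurable_itv _) lg) + _.
apply: ae_imp => t /= tP at_; have [|dt <-] := tP.
  by rewrite lte_fin.
by rewrite derive1E; split.
Qed.

End Primitive.

(** * Linear differential equations with bounded coefficients *)

Section LinearODE.
Context (R : realType).
Notation mu := (@lebesgue_measure R).

Lemma Linfty_bounded (T : R) m n (A : R -> 'M[R]_(m, n)) : Lp_itv T +oo%E A ->
  exists2 M, 0 <= M &
    {ae mu, forall t, 0 <= t <= T -> forall i j, `|A t i j| <= M}.
Proof.
move=> LA.
have bnd i j : exists M, {ae mu, forall t, 0 <= t <= T -> `|A t i j| <= M}.
  have := LA i j; rewrite inE => /andP[_]; rewrite inE/= /finite_norm unlock.
  case: ifPn => [_ ess|]; last first.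
    move=> /negP; case; rewrite -set_itvNyy.
    by rewrite [ltRHS]lebesgue_measure_itv/= addye// ltry.
  have : (ess_sup mu (EFin \o
      (fun t => `|((fun t => A t i j) \_ `[0%R, T]) t|)%R) < +oo)%E by [].
  move=> /ess_supr_bounded[M AM]; exists M.
  move: AM; apply: ae_imp => t /= + t0T.
  by rewrite patchE ifT// inE/= in_itv.
pose M i j := `|sval (cid (bnd i j))|.
have M0 i j : 0 <= M i j by exact: normr_ge0.
exists (\sum_i \sum_j M i j); first by do 2 (apply: sumr_ge0 => ? _).
have : {ae mu, forall t, forall i, forall j,
    0 <= t <= T -> `|A t i j| <= M i j}.
  apply: ae_forall => i; apply: ae_forall => j.
  move: (svalP (cid (bnd i j))); apply: ae_imp => t tM /tM.
  by move/le_trans; apply; exact: ler_norm.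
apply: ae_imp => t AM t0T i j; rewrite (le_trans (AM i j t0T))//.
exact: le_double_sum.
Qed.

Lemma is_derive_expRM (c z : R) :
  is_derive z (1 : R) (fun t => expR (c * t)) (expR (c * z) * c).
Proof.
have := is_derive1_comp (is_derive_expR (c * z))
  (is_deriveZ c (is_derive_id z (1 : R))).
by rewrite /GRing.scale/= mulr1.
Qed.

Lemma ac_expR (c a b : R) :
  absolutely_continuous_on a b (fun t => expR (c * t)).
Proof.
pose K := `|c| * expR (`|c| * (`|a| + `|b|)).
apply: (@lipschitz_ac _ _ _ _ _ K) => x y ax xy yb.
have d (z : R) := is_derive_expRM c z.
have [|z zxy ->] := MVT_segment xy (fun z _ => d z).
  apply: continuous_subspaceT => w.
  by apply: differentiable_continuous; apply/derivable1_diffP; case: (d w).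
rewrite normrM (ger0_norm (x := y - x)) ?subr_ge0//.
rewrite ler_wpM2r ?subr_ge0// normrM mulrC ler_wpM2l//.
rewrite ger0_norm ?expR_ge0// ler_expR (le_trans (ler_norm _))//.
rewrite normrM ler_wpM2l//.
move: zxy; rewrite in_itv/= => /andP[xz zy].
have := ler_norm b; have := ler_norm (- a); rewrite normrN.
have := normr_ge0 a; have := normr_ge0 b.
by rewrite ler_norml; lra.
Qed.


Definition sqnorm m n (M : 'M[R]_(m, n)) : R := \sum_i \sum_j M i j ^+ 2.

Lemma sqnorm_ge0 m n (M : 'M[R]_(m, n)) : 0 <= sqnorm M.
Proof. by do 2 (apply: sumr_ge0 => ? _); exact: sqr_ge0. Qed.

Lemma entry_le_sqnorm m n (M : 'M[R]_(m, n)) i j : M i j ^+ 2 <= sqnorm M.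
Proof.
apply: (@le_double_sum R m n (fun i j => M i j ^+ 2)) => *.
exact: sqr_ge0.
Qed.

Lemma sqnorm_eq0 m n (M : 'M[R]_(m, n)) : sqnorm M = 0 -> M = 0.
Proof.
move=> M0; apply/matrixP => i j; rewrite mxE; apply/eqP.
by rewrite -sqrf_eq0 eq_le sqr_ge0 andbT -M0 entry_le_sqnorm.
Qed.

(** The left-hand side is the derivative of [sqnorm Y] along [Y' = A Y]; the
    bound comes from [2 |x y| <= x^2 + y^2] applied to each product of
    entries. *)
Lemma sqnorm_derive_le m n (A : 'M[R]_m) (Y : 'M[R]_(m, n)) (M : R) :
  0 <= M -> (forall i j, `|A i j| <= M) ->
  `|\sum_i \sum_j (Y i j * (A *m Y) i j) *+ 2| <= (M * m%:R *+ 2) * sqnorm Y.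
Proof.
move=> M0 AM.
have e i j : `|(Y i j * (A *m Y) i j) *+ 2| <=
    \sum_k M * (Y i j ^+ 2 + Y k j ^+ 2).
  rewrite mxE mulr_sumr -sumrMnl (le_trans (ler_norm_sum _ _ _))//.
  rewrite ler_sum// => k _.
  rewrite normrMn mulrCA normrM -mulrnAr ler_pM// -normrMn ler_norml.
  have := sqr_ge0 (Y i j - Y k j); have := sqr_ge0 (Y i j + Y k j).
  by rewrite sqrrD sqrrB => ? ?; apply/andP; split; lra.
rewrite (le_trans (ler_norm_sum _ _ _))//.
apply: (@le_trans _ _ (\sum_i \sum_j \sum_k M * (Y i j ^+ 2 + Y k j ^+ 2))).
  apply: ler_sum => i _; rewrite (le_trans (ler_norm_sum _ _ _))//.
  by apply: ler_sum => j _; exact: e.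
rewrite le_eqVlt; apply/orP; left; apply/eqP.
transitivity (\sum_i \sum_j \sum_(k < m) M * Y i j ^+ 2 +
    \sum_(i < m) \sum_j \sum_(k < m) M * Y k j ^+ 2).
  rewrite -big_split/=; apply: eq_bigr => i _.
  rewrite -big_split/=; apply: eq_bigr => j _.
  by rewrite -big_split/=; apply: eq_bigr => k _; rewrite mulrDr.
have -> : \sum_(i < m) \sum_j \sum_(k < m) M * Y k j ^+ 2 = M * m%:R * sqnorm Y.
  rewrite sumr_const card_ord exchange_big/= /sqnorm -[LHS]mulr_natr mulrAC.
  congr (_ * _); rewrite mulr_sumr; apply: eq_bigr => i _.
  by rewrite mulr_sumr.
have -> : \sum_i \sum_j \sum_(k < m) M * Y i j ^+ 2 = M * m%:R * sqnorm Y.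
  rewrite /sqnorm mulr_sumr; apply: eq_bigr => i _.
  rewrite mulr_sumr; apply: eq_bigr => j _.
  by rewrite sumr_const card_ord -[LHS]mulr_natr mulrAC.
by rewrite mulrnAl mulr2n.
Qed.

(** Gronwall's inequality: with [q t = sqnorm (Y t)], the functions
    [q t * expR (- c t)] and [- q t * expR (c t)] have nonpositive derivative
    almost everywhere.  The same [C] serves for both directions of time and for
    all solutions, which later bounds [Phi T s] uniformly in [s]. *)
Lemma linear_ode_growth (T : R) n k (A : R -> 'M[R]_n) (M : R) :
  0 <= M -> {ae mu, forall t, 0 <= t <= T -> forall i j, `|A t i j| <= M} ->
  exists2 C, 0 <= C & forall Y : R -> 'M[R]_(n, k),
    ode_solution T (fun t Y => A t *m Y) Y ->
    forall s t, 0 <= s <= T -> 0 <= t <= T -> sqnorm (Y t) <= C * sqnorm (Y s).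
Proof.
move=> M0 AM; pose c := M * n%:R *+ 2.
have c0 : 0 <= c by rewrite /c mulrn_wge0// mulr_ge0.
exists (expR (c * T)); first exact: expR_ge0.
move=> Y [acY dY].
pose q t := sqnorm (Y t).
have q0 t : 0 <= q t by exact: sqnorm_ge0.
have acq : absolutely_continuous_on 0 T q.
  move/ac_mxP : acY => acY.
  apply: (@ac_sum _ _ _ _ (fun i t => \sum_j Y t i j ^+ 2)) => i.
  apply: (@ac_sum _ _ _ _ (fun j t => Y t i j ^+ 2)) => j.
  under eq_fun do rewrite expr2.
  exact: (acM (acY i j) (acY i j)).
have dq : {ae mu, forall t, 0 < t < T ->
    exists2 d, `|d| <= c * q t & is_derive t (1 : R) q d}.
  move: AM dY; apply: ae_imp2 => t AM dY /andP[t0 tT].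
  exists (\sum_i \sum_j (Y t i j * (A t *m Y t) i j) *+ 2).
    by apply: sqnorm_derive_le => //; apply: AM; rewrite !ltW.
  have /is_derive_mxP {}dY := dY (introT andP (conj t0 tT)).
  apply: (@is_derive_sum_fun _ _ _ (fun i t => \sum_j Y t i j ^+ 2)) => i.
  apply: (@is_derive_sum_fun _ _ _ (fun j t => Y t i j ^+ 2)) => j.
  under eq_fun do rewrite expr2.
  apply: (is_derive_eq (is_deriveM (dY i j) (dY i j))).
  by rewrite /GRing.scale/= mulr2n.
have fwd s t : 0 <= s -> s <= t -> t <= T ->
    q t * expR (- c * t) <= q s * expR (- c * s).
  move=> s0 st tT.
  apply: (@ac_nonincreasing _ (fun t => q t * expR (- c * t))) => //.
    exact: (acM (ac_subitv s0 tT acq) (ac_expR _ _ _)).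
  move: dq; apply: ae_imp => x dqx /andP[sx xt].
  have [|d dc dd] := dqx; first by rewrite (le_lt_trans s0)// (lt_le_trans xt).
  exists (q x * (expR (- c * x) * - c) + expR (- c * x) * d).
    rewrite mulrCA -mulrDr pmulr_rle0 ?expR_gt0// mulrN addrC subr_le0.
    by rewrite mulrC (le_trans (ler_norm _)).
  exact: (is_deriveM dd (is_derive_expRM (- c) x)).
have bwd s t : 0 <= s -> s <= t -> t <= T ->
    - (q t * expR (c * t)) <= - (q s * expR (c * s)).
  move=> s0 st tT.
  apply: (@ac_nonincreasing _ (fun t => - (q t * expR (c * t)))) => //.
    exact: (acN (acM (ac_subitv s0 tT acq) (ac_expR _ _ _))).
  move: dq; apply: ae_imp => x dqx /andP[sx xt].
  have [|d dc dd] := dqx; first by rewrite (le_lt_trans s0)// (lt_le_trans xt).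
  exists (- (q x * (expR (c * x) * c) + expR (c * x) * d)).
    rewrite oppr_le0 mulrCA -mulrDr pmulr_rge0 ?expR_gt0//.
    by move: dc; rewrite ler_norml mulrC => /andP[]; lra.
  exact: (is_deriveN (is_deriveM dd (is_derive_expRM c x))).
move=> s t /andP[s0 sT] /andP[t0 tT]; rewrite -/(q t) -/(q s).
have [st|/ltW ts] := leP s t.
  have := fwd s t s0 st tT; rewrite !mulNr !expRN.
  rewrite ler_pdivrMr ?expR_gt0// -mulrA -expRN -expRD mulrC.
  move=> /le_trans; apply.
  rewrite ler_wpM2r// ler_expR -mulrN -mulrDr ler_wpM2l//; lra.
have := bwd t s t0 ts sT; rewrite lerN2 => qq.
have : q t <= q s * expR (c * s) / expR (c * t).
  by rewrite ler_pdivlMr ?expR_gt0.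
rewrite -mulrA -expRN -expRD mulrC => /le_trans; apply.
rewrite ler_wpM2r// ler_expR -mulrN -mulrDr ler_wpM2l//; lra.
Qed.

Lemma ode_solution_linearB (T : R) m n (A : R -> 'M[R]_m)
    (w X Y : R -> 'M[R]_(m, n)) :
  ode_solution T (fun t x => A t *m x + w t) X ->
  ode_solution T (fun t x => A t *m x + w t) Y ->
  ode_solution T (fun t x => A t *m x) (fun t => X t - Y t).
Proof.
move=> [acX dX] [acY dY]; split; first exact: (acD acX (acN acY)).
move: dX dY; apply: ae_imp2 => t dX dY t0T.
apply: (is_derive_eq (is_deriveB (dX t0T) (dY t0T))).
by rewrite mulmxBr opprD addrACA subrr addr0.
Qed.

Lemma ode_solution_unique (T : R) m n (A : R -> 'M[R]_m) (w : R -> 'M[R]_(m, n))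
    (X Y : R -> 'M[R]_(m, n)) (s : R) :
  Lp_itv T +oo%E A ->
  ode_solution T (fun t x => A t *m x + w t) X ->
  ode_solution T (fun t x => A t *m x + w t) Y ->
  0 <= s <= T -> X s = Y s -> forall t, 0 <= t <= T -> X t = Y t.
Proof.
move=> /Linfty_bounded[M M0 AM] sX sY s0T XYs t t0T.
have [C C0 CP] := linear_ode_growth n M0 AM.
apply/eqP; rewrite -subr_eq0; apply/eqP/sqnorm_eq0/eqP.
rewrite eq_le sqnorm_ge0 andbT.
have := CP _ (ode_solution_linearB sX sY) s t s0T t0T.
move=> /le_trans; apply; rewrite XYs subrr.
rewrite /sqnorm big1 ?mulr0// => i _; rewrite big1// => j _.
by rewrite mxE expr0n.
Qed.

End LinearODE.

(** * The transition matrix and variation of constants *)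

Section Transition.
Context (R : realType).
Notation mu := (@lebesgue_measure R).

Lemma L2_mul_integrable (T : R) (f g : R -> R) :
  (f \_ `[0, T]) \in Lfun mu 2%:E -> (g \_ `[0, T]) \in Lfun mu 2%:E ->
  mu.-integrable `[0, T] (EFin \o (fun t => f t * g t)).
Proof.
move=> f2 g2; apply/integrable_mkcond => //.
have /Lfun1_integrable := Lfun2_mul_Lfun1 f2 g2.
congr integrable; apply/funext => t /=.
by rewrite !patchE; case: ifP => //=; rewrite mulr0.
Qed.

Lemma integrable_sumr (T : R) (I : Type) (r : seq I) (f : I -> R -> R) :
  (forall i, mu.-integrable `[0, T] (EFin \o f i)) ->
  mu.-integrable `[0, T] (EFin \o (fun t => \sum_(i <- r) f i t)).
Proof.
move=> fi.
have -> : EFin \o (fun t => \sum_(i <- r) f i t) =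
    (fun t => \sum_(i <- r) (EFin \o f i) t)%E.
  by apply/funext => t /=; rewrite sumEFin.
exact: integrable_sum.
Qed.

Lemma ode_solution_homogeneous (T : R) m n (A : R -> 'M[R]_m)
    (Y : R -> 'M[R]_(m, n)) :
  ode_solution T (fun t x => A t *m x) Y ->
  ode_solution T (fun t x => A t *m x + 0) Y.
Proof.
by congr ode_solution; apply/funext => t; apply/funext => x; rewrite addr0.
Qed.

Lemma ode_solution_mulmxr (T : R) m n p (A : R -> 'M[R]_m)
    (Y : R -> 'M[R]_(m, n)) (C : 'M[R]_(n, p)) :
  ode_solution T (fun t x => A t *m x) Y ->
  ode_solution T (fun t x => A t *m x) (fun t => Y t *m C).
Proof.
move=> [acY dY]; split; first exact: (ac_mulmx acY (ac_cst C _ _)).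
move: dY; apply: ae_imp => t dY t0T.
apply: (is_derive_eq (is_derive_mulmx (dY t0T) (is_derive_cst C t 1))).
by rewrite mulmx0 addr0 mulmxA.
Qed.

Context (T : R) (n : nat) (A : R -> 'M[R]_n) (Phi : R -> R -> 'M[R]_n).
Hypothesis T0 : 0 < T.
Hypothesis LA : Lp_itv T +oo%E A.
Hypothesis PhiP : transition_matrix T A Phi.

Let T0T : 0 <= T <= T. Proof. by rewrite ltW/=. Qed.

(** Both sides solve the same equation in [t] and agree at [t = r]. *)
Lemma transition_comp r s t : 0 <= r <= T -> 0 <= s <= T -> 0 <= t <= T ->
  Phi t s = Phi t r *m Phi r s.
Proof.
move=> r0T s0T t0T; have [Pr Prr] := PhiP r0T; have [Ps Pss] := PhiP s0T.
have := ode_solution_mulmxr (Phi r s) Pr => /ode_solution_homogeneous sr.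
move: Ps => /ode_solution_homogeneous ss.
apply: (ode_solution_unique LA ss sr r0T _ t0T).
by rewrite Prr mul1mx.
Qed.

Lemma transition_inv_l s : 0 <= s <= T -> Phi s T *m Phi T s = 1%:M.
Proof. by move=> s0T; rewrite -transition_comp//; case: (PhiP s0T). Qed.

Lemma transition_inv_r s : 0 <= s <= T -> Phi T s *m Phi s T = 1%:M.
Proof. by move=> s0T; rewrite -transition_comp//; case: (PhiP T0T). Qed.

Lemma transition_bounded : exists2 C, 0 <= C &
  forall s, 0 <= s <= T -> forall i j, `|Phi T s i j| <= C.
Proof.
have [M M0 AM] := Linfty_bounded LA.
have [C C0 CP] := linear_ode_growth n M0 AM.
exists (1 + C * sqnorm (1%:M : 'M[R]_n)).
  by rewrite addr_ge0// mulr_ge0// sqnorm_ge0.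
move=> s s0T i j; have [Ps Pss] := PhiP s0T.
have := CP _ Ps s T s0T T0T; rewrite Pss.
have := entry_le_sqnorm (Phi T s) i j; rewrite -real_normK ?num_real//.
have := sqr_ge0 (`|Phi T s i j| - 1); rewrite sqrrB1 mulr2n.
have := normr_ge0 (Phi T s i j); lra.
Qed.

(** From [Q y - Q x = Q y (P x - P y) Q x], where [Q s = Phi T s] is bounded and
    is the inverse of the absolutely continuous [P s = Phi s T].  This is what
    makes the kernel of the control operator measurable. *)
Lemma transition_ac i j : absolutely_continuous_on 0 T (fun s => Phi T s i j).
Proof.
have [acPsi _] := (PhiP T0T).1.
have [C C0 PC] := transition_bounded.
apply: (@le_ac _ _ _ _ _ _ _ (\sum_(k < n) \sum_(l < n) C * C) _ acPsi).
move=> x y x0 xy yT.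
have x0T : 0 <= x <= T by rewrite x0 (le_trans xy).
have y0T : 0 <= y <= T by rewrite yT (le_trans x0).
have -> : Phi T y i j - Phi T x i j =
    (Phi T y *m (Phi x T - Phi y T) *m Phi T x) i j.
  rewrite mulmxBr transition_inv_r// mulmxBl -mulmxA transition_inv_l//.
  by rewrite mulmx1 mul1mx !mxE.
rewrite mxE (le_trans (ler_norm_sum _ _ _))// mulr_suml ler_sum// => k _.
rewrite mxE mulr_suml (le_trans (ler_norm_sum _ _ _))// mulr_suml.
rewrite ler_sum// => l _.
rewrite !normrM mulrAC ler_pM ?mulr_ge0//; last first.
  rewrite distrC; exact: entry_le_mx_norm.
by rewrite ler_pM// PC.
Qed.

Lemma transition_measurable i j : measurable_fun `[0, T] (fun s => Phi T s i j).
Proof.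
apply: subspace_continuous_measurable_fun => //.
exact: (ac_within_continuous (transition_ac i j)).
Qed.

Context (m : nat) (B : R -> 'M[R]_(n, m)) (u : R -> 'cV[R]_m).
Hypothesis LB : Lp_itv T 2%:E B.
Hypothesis Lu : Lp_itv T 2%:E u.

Let kernel j s := (Phi T s *m B s *m u s) j 0.

Lemma control_kernel_integrable j :
  mu.-integrable `[0, T] (EFin \o (fun s => (Phi T s *m B s *m u s) j 0)).
Proof.
have -> : (fun s => (Phi T s *m B s *m u s) j 0) =
    (fun s => \sum_l \sum_k Phi T s j k * (B s k l * u s l 0)).
  apply/funext => s; rewrite mxE; apply: eq_bigr => l _; rewrite mxE mulr_suml.
  by apply: eq_bigr => k _; rewrite mulrA.
apply: integrable_sumr => l; apply: integrable_sumr => k.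
rewrite (_ : _ \o _ = (EFin \o (fun s => Phi T s j k)) \*
  (EFin \o (fun s => B s k l * u s l 0)%R))%E//.
apply: integrableMr => //.
- exact: transition_measurable.
- have [C _ PC] := transition_bounded.
  exists C; split; rewrite ?num_real// => x Cx s /=; rewrite in_itv/= => s0T.
  by rewrite (le_trans _ (ltW Cx))// PC.
- exact: L2_mul_integrable.
Qed.

Let g j : R -> R := kernel j \_ `[0, T].

Let ig j : mu.-integrable setT (EFin \o g j).
Proof.
rewrite -restrict_EFin; apply/(integrable_mkcond _ _).1 => //.
exact: control_kernel_integrable.
Qed.

(** The solution is written with [Phi t T], whose derivative in [t] is
    given, rather than with [Phi t s] under the integral: the product rule then
    applies, and [Phi t T Phi T t = 1] leaves the term [B t u t]. *)
Lemma control_solution_exists (x0 : 'cV[R]_n) :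
  exists X, [/\ control_solution T A B u X, X 0 = x0 &
    X T = Phi T 0 *m x0 + control_op T Phi B u].
Proof.
have zT : (0 : R) <= 0 <= T by rewrite lexx ltW.
pose F t : 'cV[R]_n := \col_j \int[mu]_(s in `[0, t]) g j s.
pose X t := Phi t T *m (Phi T 0 *m x0 + F t).
have [[acP dP] PTT] := PhiP T0T.
exists X; split.
- split.
    apply: (ac_mulmx acP); apply: (acD (ac_cst _ _ _)).
    apply/ac_mxP => i j; rewrite /F; under eq_fun do rewrite mxE.
    exact: primitive_ac.
  have dF : {ae mu, forall t : R, forall j, 0 < t ->
      is_derive t (1 : R) (fun t => \int[mu]_(s in `[0, t]) g j s) (g j t)}.
    by apply: ae_forall => j; exact: primitive_derive.
  move: dP dF; apply: ae_imp2 => t dP dF /andP[t0 tT].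
  have t0T : 0 <= t <= T by rewrite !ltW.
  have dFt : is_derive t (1 : R) F (Phi T t *m B t *m u t).
    apply/is_derive_mxP => i j; rewrite /F; under eq_fun do rewrite mxE.
    have := dF i t0; rewrite (ord1 j) /g patchE ifT//.
    by rewrite inE/= in_itv.
  have dZ := is_deriveD (is_derive_cst (Phi T 0 *m x0) t 1) dFt.
  apply: (is_derive_eq (is_derive_mulmx (dP (introT andP (conj t0 tT))) dZ)).
  have inv : Phi t T *m (0 + Phi T t *m B t *m u t) = B t *m u t.
    rewrite add0r -(mulmxA (Phi T t)) mulmxA transition_inv_l//.
    exact: mul1mx.
  by rewrite [X in _ + X]inv -mulmxA.
- rewrite /X mulmxDr mulmxA transition_inv_l// mul1mx.
  rewrite (_ : F 0 = 0) ?mulmx0 ?addr0//.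
  by apply/matrixP => i j; rewrite !mxE set_itv1 Rintegral_set1.
- rewrite /X PTT mul1mx; congr (_ + _); apply/matrixP => i j; rewrite !mxE.
  apply: eq_Rintegral => s sT; rewrite /g patchE ifT//.
Qed.

Lemma variation_of_constants (X : R -> 'cV[R]_n) :
  control_solution T A B u X ->
  X T = Phi T 0 *m X 0 + control_op T Phi B u.
Proof.
move=> sX; have [Y [sY Y0 <-]] := control_solution_exists (X 0).
apply: (ode_solution_unique LA sX sY (s := 0)) => //.
by apply/andP; split => //; exact: ltW.
Qed.

End Transition.

(** * The space of square integrable controls *)

Section L2.
Context (R : realType) (T : R) (m : nat).
Notation mu := (@lebesgue_measure R).
Notation L2 := (@Lp_itv R T 2%:E m 1).
Notation dot := (@L2dot R T m).

Lemma L2dot_integrable (u v : R -> 'cV[R]_m) : L2 u -> L2 v ->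
  mu.-integrable `[0, T] (EFin \o (fun t => \sum_j u t j 0 * v t j 0)).
Proof.
by move=> Lu Lv; apply: integrable_sumr => j; exact: L2_mul_integrable.
Qed.

Lemma L2_semi_inner : semi_inner L2 dot.
Proof.
have p1 : (1 <= 2%:E :> \bar R)%E by rewrite lee_fin ler1n.
have [Lfun0 LfunS] := @Lfun_submod_closed _ _ R mu _ p1.
have L0 : L2 0.
  move=> i j; rewrite (_ : _ \_ _ = 0)//.
  by apply/funext => t; rewrite patchE; case: ifP => // _; rewrite /= mxE.
have LS c u v : L2 u -> L2 v -> L2 (c *: u + v).
  move=> Lu Lv i j.
  have -> : (fun t => (c *: u + v) t i j) \_ `[0, T] =
      c *: ((fun t => u t i j) \_ `[0, T]) + (fun t => v t i j) \_ `[0, T].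
    apply/funext => t; rewrite !fctE !patchE.
    by case: ifP => _; rewrite ?mxE// scaler0 addr0.
  exact: LfunS.
split.
- exact: L0.
- by move=> u v Lu Lv; rewrite -[u]scale1r; exact: LS.
- by move=> c u Lu; rewrite -[c *: u]addr0; exact: LS.
- move=> u v _ _; apply: eq_Rintegral => t _.
  by apply: eq_bigr => j _; rewrite mulrC.
- move=> u v w Lu Lv Lw; rewrite /L2dot -RintegralD//; last 2 first.
    exact: L2dot_integrable.
    exact: L2dot_integrable.
  apply: eq_Rintegral => t _; rewrite -big_split/=; apply: eq_bigr => j _.
  by rewrite mxE mulrDl.
- move=> c u v Lu Lv; rewrite /L2dot -RintegralZl//; last first.
    exact: L2dot_integrable.
  apply: eq_Rintegral => t _; rewrite mulr_sumr; apply: eq_bigr => j _.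
  by rewrite mxE mulrA.
- move=> u Lu; apply: Rintegral_ge0 => t _; apply: sumr_ge0 => j _.
  by rewrite -expr2 sqr_ge0.
Qed.

Lemma L2dot_ae0 (u : R -> 'cV[R]_m) : L2 u ->
  {ae mu, forall t : R, 0 < t < T -> u t = 0} -> dot u u = 0.
Proof.
move=> Lu u0; rewrite /L2dot /Rintegral.
rewrite (ae_eq_integral (cst 0%E))//= ?integral0//.
- exact: (measurable_int mu (L2dot_integrable Lu Lu)).
- have e0 : {ae mu, forall t : R, t != 0}.
    exists [set 0]; split => //; first exact: lebesgue_measure_set1.
    by move=> t /= /negP; rewrite negbK => /eqP.
  have eT : {ae mu, forall t : R, t != T}.
    exists [set T]; split => //; first exact: lebesgue_measure_set1.
    by move=> t /= /negP; rewrite negbK => /eqP.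
  move: u0; apply: filterS3 e0 eT; first exact: (ae_filter_ringOfSetsType mu).
  move=> t t0 tT u0; rewrite /= in_itv/= => /andP[t0' tT'].
  rewrite u0; last by rewrite !lt_neqAle eq_sym t0 t0' tT.
  by rewrite big1// => j _; rewrite mxE mul0r.
Qed.

Lemma bounded_Lfun2 (f : R -> R) (C : R) : measurable_fun `[0, T] f ->
  (forall t, 0 <= t <= T -> `|f t| <= C) -> (f \_ `[0, T]) \in Lfun mu 2%:E.
Proof.
move=> mf fC; rewrite inE; apply/andP; split; rewrite inE/=.
  exact/(measurable_restrictT _ _).1.
have muT : (mu `[0%R, T] < +oo)%E.
  by rewrite [ltLHS]lebesgue_measure_itv/=; case: ifP => _; rewrite ltry.
have f2 : mu.-integrable `[0, T] (EFin \o (fun t => f t ^+ 2)).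
  apply: measurable_bounded_integrable => //; first exact: measurable_funX.
  exists (C ^+ 2); split; rewrite ?num_real// => x Cx s /=.
  rewrite in_itv/= => /fC fs; rewrite (le_trans _ (ltW Cx))// normrX.
  by rewrite lerXn2r ?nnegrE ?(le_trans _ fs).
rewrite /finite_norm unlock poweR_lty//.
have fin : (\int[mu]_(x in `[0%R, T])
    (abse \o (EFin \o (fun t => f t ^+ 2)%R)) x < +oo)%E.
  by apply: integrable_lty => //; exact: integrable_abse.
apply: le_lt_trans fin.
rewrite [leRHS]integral_mkcond le_eqVlt; apply/orP; left; apply/eqP.
apply: eq_integral => x _; rewrite /= !patchE; case: ifP => _ /=.
  by rewrite normrX powR_mulrn.
by rewrite normr0 powR0.
Qed.

Lemma piecewise_constant_L2 (u : R -> 'cV[R]_m) :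
  piecewise_constant T u -> L2 u.
Proof.
move=> [k [t [t0 tk tS uc]]] i j; rewrite (ord1 j) {j}.
suff [mu_ [C uC]] : measurable_fun `[0, T] (fun s => u s i 0) /\
    exists C, forall s, 0 <= s <= T -> `|u s i 0| <= C.
  exact: bounded_Lfun2 uC.
have lek l : (l <= k)%N -> 0 <= t l.
  elim: l => [_|l IH lk]; first by rewrite t0.
  by rewrite (le_trans (IH (ltnW lk)))// ltW// tS.
suff H l : (l <= k)%N -> measurable_fun `[0, t l] (fun s => u s i 0) /\
    exists C, forall s, 0 <= s <= t l -> `|u s i 0| <= C.
  by rewrite -tk; exact: H.
elim: l => [_|l IH lk].
  rewrite t0; split; first by rewrite set_itv1; exact: measurable_fun_set1.
  exists `|u 0 i 0| => s s0.
  by rewrite (_ : s = 0)//; apply/eqP; rewrite eq_le andbC.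
have [ml [C uC]] := IH (ltnW lk); have [c cP] := uc _ lk.
have tl := tS _ lk; have tl0 := lek _ (ltnW lk).
split.
  have -> : [set` `[0, t l.+1]] = [set` `[0, t l]] `|`
      ([set` `]t l, t l.+1[] `|` [set t l.+1]) :> set R.
    apply/seteqP; split => x /=; rewrite !in_itv/=.
      move=> /andP[x0 xl].
      have [xt|tx] := leP x (t l); first by left; rewrite x0.
      have [->|xt] := eqVneq x (t l.+1); first by right; right.
      by right; left; rewrite lt_neqAle xt.
    move=> [/andP[-> xt]|[/andP[tx /ltW ->]|->]] /=.
    - by rewrite (le_trans xt)// ltW.
    - by rewrite (le_trans tl0)// ltW.
    - by rewrite lexx (le_trans tl0)// ltW.
  apply/measurable_funU => //; first exact: measurableU.
  split => //; apply/measurable_funU => //.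
  split; last exact: measurable_fun_set1.
  apply: (eq_measurable_fun (cst (c i 0))) => // x.
  by rewrite inE/= in_itv/= => /cP ->.
exists (Num.max C (Num.max `|c i 0| `|u (t l.+1) i 0|)) => s /andP[s0 st].
rewrite !le_max; have [sl|sl] := leP s (t l); first by rewrite uC// s0.
have [->|st'] := eqVneq s (t l.+1); first by rewrite lexx !orbT.
by rewrite (cP s) ?lexx ?orbT// sl lt_neqAle st'.
Qed.

(** Uniform grids with [K] and [K'] cells have a common refinement with [K * K']
    cells, so these controls form a linear subspace, and no partition points
    have to be sorted. *)
Definition grid_constant (u : R -> 'cV[R]_m) :=
  exists2 K : nat, (0 < K)%N & forall i, (i < K)%N -> exists c, forall x,
    T * i%:R / K%:R < x < T * i.+1%:R / K%:R -> u x = c.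

Hypothesis T0 : 0 < T.

Lemma grid_constant_piecewise u : grid_constant u -> piecewise_constant T u.
Proof.
move=> [K K0 uc]; exists K, (fun i => T * i%:R / K%:R).
have K0' : 0 < K%:R :> R by rewrite ltr0n.
split => //.
- by rewrite mulr0 mul0r.
- by rewrite mulfK// gt_eqF.
- by move=> i iK; rewrite ltr_pM2r ?invr_gt0// ltr_pM2l// ltr_nat.
Qed.

Lemma grid_constantD u v :
  grid_constant u -> grid_constant v -> grid_constant (u + v).
Proof.
have refine w K K' i : (0 < K)%N -> (0 < K')%N -> (i < K * K')%N ->
    (forall i, (i < K)%N -> exists c : 'cV[R]_m, forall x,
      T * i%:R / K%:R < x < T * i.+1%:R / K%:R -> w x = c) ->
    exists c : 'cV[R]_m, forall x,
      T * i%:R / (K * K')%:R < x < T * i.+1%:R / (K * K')%:R -> w x = c.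
  move=> K0 K'0 iKK wc.
  have [|c cP] := wc (i %/ K')%N; first by rewrite ltn_divLR.
  exists c => x /andP[ix xi]; apply: cP.
  have K0' : 0 < K%:R :> R by rewrite ltr0n.
  have K'0' : 0 < K'%:R :> R by rewrite ltr0n.
  have e j : T * j%:R / K%:R = T * (j * K')%:R / (K * K')%:R.
    by rewrite !natrM; field; rewrite !gt_eqF.
  have KK0 : 0 < (K * K')%:R :> R by rewrite ltr0n muln_gt0 K0.
  rewrite !e (le_lt_trans _ ix) ?(lt_le_trans xi)//.
    by rewrite ler_pM2r ?invr_gt0// ler_pM2l// ler_nat ltn_ceil.
  by rewrite ler_pM2r ?invr_gt0// ler_pM2l// ler_nat leq_trunc_div.
move=> [K K0 uc] [K' K'0 vc]; exists (K * K')%N; first by rewrite muln_gt0 K0.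
move=> i iKK; have [c cP] := refine u K K' i K0 K'0 iKK uc.
have iK'K : (i < K' * K)%N by rewrite mulnC.
have [c' cP'] := refine v K' K i K'0 K0 iK'K vc.
exists (c + c') => x xi; rewrite !fctE (cP _ xi) cP'//.
by rewrite (mulnC K').
Qed.

Lemma grid_constantZ c u : grid_constant u -> grid_constant (c *: u).
Proof.
move=> [K K0 uc]; exists K => // i iK; have [d dP] := uc i iK.
by exists (c *: d) => x xi; rewrite !fctE dP.
Qed.

(** Testing against the indicator of [0, T i / K] in coordinate [j] shows that
    the primitive [F j] of [z j] vanishes at all grid points, hence everywhere
    by continuity; its derivative is [z j] almost everywhere. *)
Lemma grid_constant_dense (z : R -> 'cV[R]_m) : L2 z ->
  (forall u, L2 u /\ grid_constant u -> dot u z = 0) -> dot z z = 0.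
Proof.
move=> Lz orth.
pose zj j : R -> R := (fun t => z t j 0) \_ `[0, T].
have izj j : mu.-integrable `[0, T] (EFin \o (fun t => z t j 0)).
  have m1 : measurable_fun `[0, T] (cst (1 : R)) by exact: measurable_cst.
  have L1 : ((cst 1 : R -> R) \_ `[0, T]) \in Lfun mu 2%:E.
    by apply: (bounded_Lfun2 m1 (C := 1)) => t _ /=; rewrite normr1.
  have := L2_mul_integrable L1 (Lz j 0).
  by congr integrable; apply/funext => t; rewrite /= mul1r.
have ig j : mu.-integrable setT (EFin \o zj j).
  by rewrite -restrict_EFin; apply/(integrable_mkcond _ _).1.
pose F j t := \int[mu]_(s in `[0, t]) zj j s.
have acF j : absolutely_continuous_on 0 T (F j) by exact: primitive_ac.
have Fgrid j K i : (0 < K)%N -> (i <= K)%N -> F j (T * i%:R / K%:R) = 0.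
  move=> K0 iK; set c := T * i%:R / K%:R.
  have K0' : 0 < K%:R :> R by rewrite ltr0n.
  have cT : c <= T.
    by rewrite /c -mulrA ger_pMr// ler_pdivrMr// mul1r ler_nat.
  pose u (t : R) : 'cV[R]_m := (t <= c)%R%:R *: delta_mx j 0.
  have gu : grid_constant u.
    exists K => // l lK; exists ((l < i)%:R *: delta_mx j 0) => x /andP[lx xl].
    congr (_%:R *: _); congr nat_of_bool; apply/idP/idP => [xc|li].
      have := lt_le_trans lx xc.
      by rewrite ltr_pM2r ?invr_gt0// ltr_pM2l// ltr_nat.
    rewrite (le_trans (ltW xl))//.
    by rewrite ler_pM2r ?invr_gt0// ler_pM2l// ler_nat.
  have := orth u (conj (piecewise_constant_L2 (grid_constant_piecewise gu)) gu).
  move=> <-; rewrite /F /L2dot.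
  rewrite [LHS]Rintegral_mkcond [RHS]Rintegral_mkcond; congr Rintegral.
  apply/funext => t; rewrite !patchE.
  have -> : (t \in [set` `[0, c]]) = (t \in [set` `[0, T]]) && (t <= c).
    apply/idP/andP => [|[]]; rewrite !inE/= !in_itv/=.
      by move=> /andP[-> tc]; split => //; exact: le_trans cT.
    by move=> /andP[-> _] ->.
  have [tD|//] := boolP (t \in [set` `[0, T]]).
  rewrite /zj patchE tD (bigD1 j)//= big1 => [|l lj]; last first.
    by rewrite /u !mxE (negPf lj)/= mulr0 mul0r.
  rewrite addr0 /u !mxE !eqxx/= mulr1.
  by case: (t <= c); rewrite ?mul1r ?mul0r.
have F0 j t : 0 <= t <= T -> F j t = 0.
  move=> /andP[t0 tT]; apply/eqP; rewrite -normr_eq0 eq_le normr_ge0 andbT.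
  apply/ler_addgt0Pr => e e0; rewrite add0r.
  have [d d0 small] := ac_small (acF j) e0.
  pose K := (Num.truncn (T / d)).+1.
  have K0 : 0 < K%:R :> R by rewrite ltr0n.
  have TKd : T / K%:R < d.
    by rewrite ltr_pdivrMr// -ltr_pdivrMl// mulrC truncnS_gt.
  pose i := Num.truncn (t * K%:R / T).
  have x0 : 0 <= t * K%:R / T by rewrite divr_ge0 ?mulr_ge0// ltW.
  have ix : i%:R <= t * K%:R / T by rewrite truncn_le.
  have xi : t * K%:R / T < i.+1%:R by exact: truncnS_gt.
  have iK : (i <= K)%N.
    rewrite -(ler_nat R) (le_trans ix)// ler_pdivrMr// mulrC ler_pM2l//.
  rewrite -[F j t]subr0 -(Fgrid j K i)// ltW// small//.
  - by rewrite divr_ge0// mulr_ge0// ltW.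
  - by rewrite ler_pdivrMr// mulrC -ler_pdivlMr// .
  - rewrite (le_lt_trans _ TKd)//.
    have : t <= T * i.+1%:R / K%:R.
      by rewrite ler_pdivlMr// -ler_pdivrMl// mulrC ltW.
    by rewrite -natr1 mulrDr mulr1 mulrDl; lra.
apply: L2dot_ae0 => //.
have : {ae mu, forall t : R, forall j, 0 < t ->
    is_derive t (1 : R) (F j) (zj j t)}.
  by apply: ae_forall => j; exact: primitive_derive.
apply: ae_imp => t dF /andP[t0 tT]; apply/matrixP => j k; rewrite (ord1 k) mxE.
have [_ dFt] := dF j t0.
have zt : zj j t = z t j 0.
  by rewrite /zj patchE ifT// inE/= in_itv/= !ltW.
rewrite -zt -dFt.
have : is_derive t (1 : R) (F j) 0.
  apply: (near_eq_is_derive _ (is_derive_cst 0 t 1)).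
  have : t \in `]0, T[ by rewrite in_itv/= t0.
  move=> /near_in_itvoo; apply: filterS => s; rewrite in_itv/= => /andP[s0 sT].
  by rewrite F0// !ltW.
by case.
Qed.

End L2.

(** * The control operator and its adjoint *)

Section Adjoint.
Context (R : realType) (T : R) (n m : nat).
Context (L : (R -> 'cV[R]_m) -> 'cV[R]_n) (Ls : 'cV[R]_n -> (R -> 'cV[R]_m)).
Hypothesis LsP : is_adjoint T L Ls.
Notation L2 := (@Lp_itv R T 2%:E m 1).
Notation dot := (@L2dot R T m).
Notation e j := (Ls (delta_mx j 0)).

Lemma adjoint_L2 x : L2 (Ls x).
Proof. by case: (LsP x). Qed.

Lemma adjoint_coord u j : L2 u -> dot u (e j) = L u j 0.
Proof.
move=> Lu; have [_ <-//] := LsP (delta_mx j 0).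
rewrite /edot (bigD1 j)//= big1 => [|k kj]; last first.
  by rewrite mxE (negPf kj) mulr0.
by rewrite mxE !eqxx mulr1 addr0.
Qed.

Lemma adjoint_orthogonal_ker x h : L2 h -> (forall j, dot h (e j) = 0) ->
  dot (Ls x) h = 0.
Proof.
move=> Lh h0; rewrite (si_sym (L2_semi_inner T m) (adjoint_L2 x) Lh).
have [_ <-//] := LsP x; rewrite /edot big1// => j _.
by rewrite -adjoint_coord// h0 mul0r.
Qed.

(** The chosen inverse of [L \o Ls] is a right inverse on the range of [L]: if
    [x] is the coefficient vector of the projection of [u] onto the span of the
    [Ls (delta_mx j 0)], then [L (Ls x) = L u]. *)
Lemma adj_gram_invK u : L2 u -> L (adj_gram_inv L Ls (L u)) = L u.
Proof.
move=> Lu; rewrite /adj_gram_inv.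
have [H HP] := gram_projection (L2_semi_inner T m)
  (fun j => adjoint_L2 (delta_mx j 0)).
pose x : 'cV[R]_n := \col_q \sum_r H q r * dot u (e r).
suff Lx : L (Ls x) = L u.
  by apply: (@pinvK _ _ _ setT (L \o Ls)); rewrite inE; exists x.
apply/matrixP => p k; rewrite (ord1 k) -!adjoint_coord//; last first.
  exact: adjoint_L2.
rewrite -(HP u Lu p).
rewrite (si_sym (L2_semi_inner T m)) //; [|exact: adjoint_L2..].
have [_ <-] := LsP x; last exact: adjoint_L2.
rewrite (si_suml (L2_semi_inner T m))//; last 2 first.
- by move=> i; exact: adjoint_L2.
- exact: adjoint_L2.
rewrite /edot; apply: eq_bigr => q _.
rewrite mxE mulrC -adjoint_coord; last exact: adjoint_L2.
by rewrite (si_sym (L2_semi_inner T m))//; exact: adjoint_L2.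
Qed.

End Adjoint.

Theorem theorem3 (R : realType) (T : R) (N n m : nat)
    (K : set R) (beta : 'I_N -> R)
    (A : R -> R -> 'M[R]_n) (B : R -> R -> 'M[R]_(n, m))
    (Phi : R -> R -> R -> 'M[R]_n)
    (Ladj : 'I_N -> 'cV[R]_n -> (R -> 'cV[R]_m))
    (X0 XF : R -> 'cV[R]_n) (lambda : 'I_N -> R)
    (u : nat -> (R -> 'cV[R]_m)) :
  let L i := control_op T (fun t s => Phi t s (beta i)) (B ^~ (beta i)) in
  let xi i := XF (beta i) - Phi T 0 (beta i) *m X0 (beta i) in
  0 < T ->
  compact K -> (forall i, K (beta i)) ->
  (forall i, Lp_itv T +oo%E (A ^~ (beta i))) ->
  (forall i, Lp_itv T 2%:E (B ^~ (beta i))) ->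
  (forall i, transition_matrix T (A ^~ (beta i))
               (fun t s => Phi t s (beta i))) ->
  (forall i, is_adjoint T (L i) (Ladj i)) ->
  (forall i, controllable T (L i)) ->
  (forall i, 0 < lambda i < 1) -> \sum_i lambda i = 1 ->
  (forall k, Lp_itv T 2%:E (u k)) ->
  (forall k, {ae @lebesgue_measure R, forall t, 0 <= t <= T ->
     u k.+1 t =
       (u k t - \sum_i lambda i *: adj_gram_inv (L i) (Ladj i) (L i (u k)) t)
       + \sum_i lambda i *: adj_gram_inv (L i) (Ladj i) (xi i) t}) ->
  ensemble_reachable T beta A B X0 XF <->
  exists ustar : R -> 'cV[R]_m,
    [/\ Lp_itv T 2%:E ustar,
        (fun k => L2norm T (u k \- ustar)) @ \oo --> (0 : R) &
        forall i, L i ustar = xi i].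
Proof.
move=> L xi T0 _ _ LA LB PhiP Lad _ lam01 lam1 Lu step.
have ip := L2_semi_inner T m.
pose a (i : 'I_N) (j : 'I_n) := Ladj i (delta_mx j 0).
have Da i j : Lp_itv T 2%:E (a i j) by exact: (adjoint_L2 (Lad i)).
pose b (q : 'I_N * 'I_n) := a q.1 q.2.
have Db q : Lp_itv T 2%:E (b q) by exact: Da.
have La i j v : Lp_itv T 2%:E v -> L2dot T v (a i j) = L i v j 0.
  exact: (adjoint_coord (Lad i)).
split=> [reach|[v [Lv _ vxi]]].
- have [w Lw wxi'] : exists2 w, Lp_itv T 2%:E w &
      forall q, L2dot T w (b q) = xi q.1 q.2 0.
    apply: (range_closed ip Db) => eps eps0.
    have [v [X [pcv sX X0E dX]]] := reach eps eps0.
    have Lv := piecewise_constant_L2 pcv.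
    exists v => // -[i j] /=; rewrite La//.
    apply: le_lt_trans dX.
    have := variation_of_constants T0 (LA i) (PhiP i) (LB i) Lv (sX i).
    rewrite X0E -/(L i v) => XT.
    have -> : L i v j 0 - xi i j 0 = X T i j 0 - XF (beta i) j 0.
      by rewrite XT /xi !mxE; ring.
    rewrite -sqrtr_sqr ler_wsqrtr//.
    apply: (@le_double_sum R N n (fun i j =>
      (X T i j 0 - XF (beta i) j 0) ^+ 2)) => *.
    exact: sqr_ge0.
  have wxi i : L i w = xi i.
    by apply/matrixP => j l; rewrite (ord1 l) -La// (wxi' (i, j)).
  pose e k := u k - w.
  (* The difference of the two correction terms of the iteration is a
     projection of [e k], although [Ladj i] is linear only up to null sets. *)
  pose p k i := adj_gram_inv (L i) (Ladj i) (L i (u k)) -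
                adj_gram_inv (L i) (Ladj i) (xi i).
  have Le k : Lp_itv T 2%:E (e k) by exact: (si_memB ip).
  have Linv i y : Lp_itv T 2%:E (adj_gram_inv (L i) (Ladj i) y).
    exact: (adjoint_L2 (Lad i)).
  have Lpk k i : Lp_itv T 2%:E (p k i) by exact: (si_memB ip).
  have lam0 i : 0 < lambda i by case/andP: (lam01 i).
  have [h [Lh ha cvh]] : exists h, [/\ Lp_itv T 2%:E h,
      forall i j, L2dot T h (a i j) = 0 &
      (fun k => Num.sqrt (L2dot T (e k - h) (e k - h))) @ \oo --> (0 : R)].
    apply: (cimmino ip Da lam0 lam1 Le Lpk).
    + move=> k i j; rewrite !(si_Bl ip)// !La//.
      by rewrite (adj_gram_invK (Lad i))// -wxi (adj_gram_invK (Lad i)).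
    + move=> k i g Lg g0; rewrite (si_Bl ip)//.
      by rewrite !(adjoint_orthogonal_ker (Lad i))// subrr.
    + move=> k d; apply: L2dot_ae0.
        apply: (si_memB ip) => //; apply: (si_memB ip) => //.
        by apply: (si_mem_sum ip) => i; exact: (si_memZ ip).
      have := step k; apply: ae_imp => t st /andP[t0 tT].
      rewrite /d /e /p !fctE st ?ltW//.
      rewrite fct_sumE [X in _ - (_ - X)](eq_bigr (fun i =>
        lambda i *: adj_gram_inv (L i) (Ladj i) (L i (u k)) t -
        lambda i *: adj_gram_inv (L i) (Ladj i) (xi i) t)).
        rewrite sumrB; move: (\sum_i _) (\sum_i _) (u k t) (w t) => s1 s2 x y.
        by apply/matrixP => j l; rewrite !mxE; ring.
      by move=> i _; rewrite -scalerBr.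
  exists (w + h); split.
  + exact: (si_memD ip).
  + have -> : (fun k => L2norm T (u k \- (w + h))) =
        (fun k => Num.sqrt (L2dot T (e k - h) (e k - h)))%R; last exact: cvh.
    apply/funext => k; rewrite /L2norm (_ : u k \- (w + h) = e k - h)//.
    by rewrite /e -addrA -opprD.
  + move=> i; apply/matrixP => j l; rewrite (ord1 l) -La; last first.
      exact: (si_memD ip).
    by rewrite (si_addl ip)// ha addr0 La// wxi.
- have [w [Lw gw] wv] : exists2 w, Lp_itv T 2%:E w /\ grid_constant T w &
      forall q, L2dot T w (b q) = L2dot T v (b q).
    apply: (dense_interpolation ip
      (P := fun w => Lp_itv T 2%:E w /\ grid_constant T w)) => //.
    + by move=> ? [].
    + split; first exact: (si_mem0 ip).
      by exists 1%N => // i _; exists 0.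
    + move=> f g [Lf gf] [Lg gg]; split; first exact: (si_memD ip).
      exact: grid_constantD.
    + move=> c f [Lf gf]; split; first exact: (si_memZ ip).
      exact: grid_constantZ.
    + by move=> z Lz zo; apply: grid_constant_dense.
  have wxi i : L i w = xi i.
    apply/matrixP => j l; rewrite (ord1 l) -La// (wv (i, j)) La//=.
    by rewrite vxi.
  have sol i : exists X,
      [/\ control_solution T (A ^~ (beta i)) (B ^~ (beta i)) w X,
          X 0 = X0 (beta i) & X T = XF (beta i)].
    have [X [sX X0E XT]] :=
      control_solution_exists T0 (LA i) (PhiP i) (LB i) Lw (X0 (beta i)).
    exists X; split => //; rewrite XT -/(L i w) wxi /xi addrC subrK//.
  move=> eps eps0; exists w, (fun t i => sval (cid (sol i)) t); split.
  + exact: grid_constant_piecewise.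
  + by move=> i; case: (svalP (cid (sol i))).
  + by move=> i; case: (svalP (cid (sol i))).
  + rewrite /ensemble_dist big1 ?sqrtr0// => i _; rewrite big1// => j _.
    by have [_ _ ->] := svalP (cid (sol i)); rewrite subrr expr0n.
Qed.
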